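(* Let $\hat y=K\hat x$ and let $Y_1,Y_2,\dots$ be i.i.d. $\mathcal{Y}$-valued random variables with $\mathbb{E}[Y_1]=\hat y$ and $\mathbb{E}\|Y_1-\hat y\|^2<\infty$. Assume there are $q>0$, $p>1$ with $q>p-1$, $\sigma_j^2\asymp j^{-q}$ and $\mathbb{E}(Y_1-\hat y,u_j)^2\asymp j^{-p}$. Let $\varepsilon>0$ with $p>1+\varepsilon$, set $d_j:=j^{\frac{p-1-\varepsilon}{2}}$, and assume $\hat x\in\mathcal{X}_{\nu,\rho}$ with $\nu,\rho>0$. Define $$\delta_n':=\frac{1}{\sqrt n}\sqrt{\frac{1}{n-1}\sum_{i=1}^n\sum_{j=1}^\infty d_j^2(Y_i-\bar Y_n,u_j)^2},\qquad k_n:=\min\Big\{k\ge0:\ \sqrt{\textstyle\sum_{j=k+1}^\infty d_j^2(\bar Y_n,u_j)^2}\le\delta_n'\Big\}.$$ Let $\nu':=\frac{q}{q+1+\varepsilon-p}\nu$. Then there exists $L>0$ such that $$\mathbb{P}\left(\|\bar X^n_{k_n}-\hat x\|\le L\,\rho^{\frac{1}{1+\nu'}}\left(\frac{1}{\sqrt n}\right)^{\frac{\nu'}{\nu'+1}}\right)\to1\quad (n\to\infty).$$ (Note $\frac{\nu'}{\nu'+1}=\frac{\nu}{\nu+1-\frac{p-1-\varepsilon}{q}}$.)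
   Context: $\mathcal{X},\mathcal{Y}$ are infinite-dimensional real separable Hilbert spaces and $K:\mathcal{X}\to\mathcal{Y}$ is a compact linear operator with dense range, with singular value decomposition $(\sigma_j,u_j,v_j)_{j\in\mathbb{N}}$: $(u_j)$ is an orthonormal basis of $\mathcal{Y}$, $(v_j)$ an orthonormal basis of $\mathcal{N}(K)^\perp$, $(\sigma_j)$ is a nonincreasing sequence of positive numbers converging to $0$, and $Kv_j=\sigma_ju_j$. For $\nu,\rho>0$, $\mathcal{X}_{\nu,\rho}:=\{(K^*K)^{\nu/2}\xi:\xi\in\mathcal{X},\|\xi\|\le\rho\}=\{\sum_j\sigma_j^\nu(\xi,v_j)v_j:\|\xi\|\le\rho\}$. $\bar Y_n:=\frac1n\sum_{i=1}^nY_i$ and $\bar X^n_k:=\sum_{j=1}^k\sigma_j^{-1}(\bar Y_n,u_j)v_j$ (with $\bar X^n_0=0$). $a_j\asymp b_j$ means $cb_j\le a_j\le Cb_j$ for constants $0<c\le C$ independent of $j$. *)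

(* Defs.v *)
From HB Require Import structures.
From mathcomp Require Import all_boot all_order all_algebra.
From mathcomp Require Import all_classical all_reals all_analysis.
Set Implicit Arguments. Unset Strict Implicit. Unset Printing Implicit Defensive.
Import Order.TTheory GRing.Theory Num.Theory.
Import numFieldNormedType.Exports.
Local Open Scope classical_set_scope.
Local Open Scope ring_scope.

Section HilbertDefs.
Context {R : realType}.

(* A real inner product inducing the norm of V (V complete => Hilbert). *)
Record inner_product (V : normedModType R) := InnerProduct {
  ip : V -> V -> R;
  ip_sym : forall x y, ip x y = ip y x;
  ip_linl : forall (a : R) (x y z : V), ip (a *: x + y) z = a * ip x z + ip y z;
  ip_norm : forall x, `|x| = Num.sqrt (ip x x) }.

Definition separable (V : topologicalType) :=
  exists D : set V, countable D /\ closure D = setT.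

Definition orthonormal (V : normedModType R) (ipV : inner_product V) (e : nat -> V) :=
  forall i j : nat, ip ipV (e i) (e j) = (i == j)%:R.

Definition expands (V : normedModType R) (ipV : inner_product V) (e : nat -> V) (x : V) :=
  (fun n : nat => \sum_(j < n) (ip ipV x (e j)) *: e j) @ \oo --> x.

Definition onb_of (V : normedModType R) (ipV : inner_product V) (e : nat -> V) (S : set V) :=
  orthonormal ipV e /\ (forall j, S (e j)) /\ (forall x, S x -> expands ipV e x).

Definition onb (V : normedModType R) (ipV : inner_product V) (e : nat -> V) :=
  onb_of ipV e setT.

Definition kernel_perp (X Y : normedModType R) (ipX : inner_product X) (K : X -> Y) : set X :=
  [set x | forall z, K z = 0 -> ip ipX x z = 0].

Definition source_set (X : normedModType R) (ipX : inner_product X)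
    (sigma : nat -> R) (v : nat -> X) (nu rho : R) : set X :=
  [set x | exists xi : X, `|xi| <= rho /\
     (fun n : nat => \sum_(j < n) (sigma j `^ nu * ip ipX xi (v j)) *: v j) @ \oo --> x].

Definition borel_sets (V : topologicalType) : set (set V) := <<s [set A | open A] >>.

Section Prob.
Context {d : measure_display} {T : measurableType d}.

Definition borel_rv (V : topologicalType) (Z : T -> V) :=
  forall B, borel_sets B -> measurable (Z @^-1` B).

Definition mutually_independent (P : probability T R) (V : topologicalType) (Yr : nat -> T -> V) :=
  forall (I : seq nat) (B : nat -> set V), uniq I ->
    (forall i, i \in I -> borel_sets (B i)) ->
    P (\bigcap_(i in [set i | i \in I]) (Yr i @^-1` B i)) =
    (\prod_(i <- I) P (Yr i @^-1` B i))%E.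

Definition identically_distributed (P : probability T R) (V : topologicalType) (Yr : nat -> T -> V) :=
  forall i B, borel_sets B -> P (Yr i @^-1` B) = P (Yr 0%N @^-1` B).

(* The paper's Y_1, ..., Y_n are Yr 0, ..., Yr (n-1); u j is the paper's u_{j+1}. *)
Definition Ybar (Y : normedModType R) (Yr : nat -> T -> Y) (n : nat) (w : T) : Y :=
  n%:R^-1 *: \sum_(i < n) Yr i w.

Definition Xbar (X Y : normedModType R) (ipY : inner_product Y) (sigma : nat -> R)
    (u : nat -> Y) (v : nat -> X) (Yr : nat -> T -> Y) (n k : nat) (w : T) : X :=
  \sum_(j < k) ((sigma j)^-1 * ip ipY (Ybar Yr n w) (u j)) *: v j.

(* d_j = j^((p-1-eps)/2), paper index j = our j+1 *)
Definition dw (p eps : R) (j : nat) : R := (j.+1)%:R `^ ((p - 1 - eps) / 2).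

(* delta'_n (possibly +oo, hence extended real) *)
Definition delta' (Y : normedModType R) (ipY : inner_product Y) (u : nat -> Y)
    (p eps : R) (Yr : nat -> T -> Y) (n : nat) (w : T) : \bar R :=
  ((Num.sqrt n%:R)^-1)%:E *
  sqrte (((n.-1)%:R^-1)%:E *
    \sum_(i < n) \sum_(0 <= j <oo)
       ((dw p eps j ^+ 2 * (ip ipY (Yr i w - Ybar Yr n w) (u j)) ^+ 2)%:E))%E.

Definition tail_res (Y : normedModType R) (ipY : inner_product Y) (u : nat -> Y)
    (p eps : R) (Yr : nat -> T -> Y) (n k : nat) (w : T) : \bar R :=
  sqrte (\sum_(k <= j <oo) ((dw p eps j ^+ 2 * (ip ipY (Ybar Yr n w) (u j)) ^+ 2)%:E))%E.

Definition is_kn (Y : normedModType R) (ipY : inner_product Y) (u : nat -> Y)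
    (p eps : R) (Yr : nat -> T -> Y) (n : nat) (w : T) (k : nat) : Prop :=
  (tail_res ipY u p eps Yr n k w <= delta' ipY u p eps Yr n w)%E /\
  forall k', (k' < k)%N -> ~ (tail_res ipY u p eps Yr n k' w <= delta' ipY u p eps Yr n w)%E.

End Prob.
End HilbertDefs.

(* Main.v *)
(* Write e for the noise of the sample mean and d for the weights d_j. As d_j^2 times
   the j-th noise variance is of order j^(-1-eps), the d-weighted sample variance has
   finite expectation; the weak law (by truncation, only a first moment is available)
   shows that delta'_n^2 lies between fixed multiples of 1/n with probability tending
   to one. The norm of e itself is not below delta'_n with high probability, but its
   tail beyond K_n = A n^b, b = 1/(q + 1 + eps - p + q nu), is, so k_n <= K_n for A
   large. Below K_n the variance term is smaller than the squared rate r_n by a factor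
   n^(-b eps/2); the bias on (k_n, K_n] is controlled by the residual, at most delta'_n,
   times max 1/(sigma_j d_j)^2, and beyond K_n by the source condition. *)

Require Import Defs.
From HB Require Import structures.
From mathcomp Require Import all_boot all_order all_algebra.
From mathcomp Require Import all_classical all_reals all_analysis.
From mathcomp Require Import measurable_realfun ring lra.
Import Order.TTheory GRing.Theory Num.Theory.
Import numFieldNormedType.Exports.
Local Open Scope classical_set_scope.
Local Open Scope ring_scope.

(** * Probability *)

Section independence.
Context {R : realType} {d : measure_display} {T : measurableType d}.
Context (P : probability T R).
Local Open Scope ereal_scope.

(** The proof separates a deterministic inequality for one fixed sample ([discrepancy_error]) from
    five families of events of vanishing probability outside which its hypotheses hold. On a fixed
    sample, the stopping index exists and is at most K_n as soon as the residual at K_n is at most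
    [delta'_n]. There signal and noise compete with a fixed multiple of 1/n. The signal is made
    small against it by the constant A alone, whereas the noise is of smaller order whatever the
    constants: of the factor j^(-1-eps) in its weighted variances, half of eps is given up for decay
    in n, and the exponent 1 + eps/2 is kept for summability. The same halving gives the gain in the
    variance term below K_n. The lower bound on [delta'_n] cannot rest on a variance of squared
    coordinates, as no fourth moments are assumed; it uses the coordinate of index 0 alone, whose
    weight is 1, and the square of that coordinate capped at 1, which still has a positive mean. *)

Definition indep_rv (A B : T -> R) := forall U V : set R,
  measurable U -> measurable V ->
  P (A @^-1` U `&` B @^-1` V) = P (A @^-1` U) * P (B @^-1` V).

(* The law of (A, B) is the product of the two laws, so Fubini applies. *)
Lemma indep_expectation_mul (A B : T -> R) :
  measurable_fun setT A -> measurable_fun setT B -> indep_rv A B ->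
  A \in Lfun P 1 -> B \in Lfun P 1 -> (A \* B)%R \in Lfun P 1 ->
  'E_P[A \* B] = 'E_P[A] * 'E_P[B].
Proof.
move=> mA mB iAB /Lfun1_integrable intA /Lfun1_integrable intB.
move=> /Lfun1_integrable intAB; rewrite unlock.
pose A' : {RV P >-> R} := HB.pack A (isMeasurableFun.Build _ _ _ _ A mA).
pose B' : {RV P >-> R} := HB.pack B (isMeasurableFun.Build _ _ _ _ B mB).
pose AB w := (A w, B w).
have mAB : measurable_fun setT AB by exact: measurable_fun_pair.
pose AB' : {RV P >-> (R * R)%type} := HB.pack AB (isMeasurableFun.Build _ _ _ _ AB mAB).
pose f (x : R * R) : \bar R := (x.1 * x.2)%:E.
have mf : measurable_fun [set: R * R] f.
  apply/measurable_EFinP; apply: measurable_funM.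
    exact: measurable_fst.
  exact: measurable_snd.
have E1 : \int[distribution P AB']_x f x = \int[P]_w (A w * B w)%:E.
  by rewrite integral_distribution.
have E2 (X : set (R * R)) : measurable X ->
    (distribution P A' \x distribution P B') X = distribution P AB' X.
  apply: product_measure_unique => U V mU mV.
  exact: iAB.
have E3 : \int[distribution P AB']_x f x =
          \int[distribution P A' \x distribution P B']_x f x.
  apply: eq_measure_integral => X mX _; exact: (esym (E2 X mX)).
have intf : (distribution P A' \x distribution P B').-integrable setT f.
  apply/integrableP; split => //.
  rewrite (eq_measure_integral (distribution P AB')); last first.
    by move=> X mX _; exact: (E2 X mX).
  rewrite ge0_integral_distribution//; last exact: measurableT_comp.
  by move/integrableP : intAB => [].
rewrite -[LHS]E1 E3 -integral12_prod_meas1//.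
have mE : measurable_fun [set: R] (fun x : R => x%:E).
  by apply/measurable_EFinP; exact: measurable_id.
have iB : \int[distribution P B']_y y%:E = \int[P]_w (B w)%:E.
  by rewrite integral_distribution.
have iA : \int[distribution P A']_y y%:E = \int[P]_w (A w)%:E.
  by rewrite integral_distribution.
rewrite /fubini_F /f /=.
have fB : \int[P]_w (B w)%:E \is a fin_num.
  exact: integrable_fin_num.
have iAD : (distribution P A').-integrable setT (fun x : R => x%:E).
  exact: integrable_pushforward.
have iBD : (distribution P B').-integrable setT (fun x : R => x%:E).
  exact: integrable_pushforward.
transitivity (\int[distribution P A']_x (x%:E * \int[P]_w (B w)%:E)).
  apply: eq_integral => x _; rewrite -iB.
  under eq_integral do rewrite EFinM.
  by rewrite integralZl.
by rewrite -(fineK fB) integralZr// iA.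
Qed.

Lemma measurable_sqr_Lfun2 (X : T -> R) : measurable_fun setT X ->
  \int[P]_w (X w ^+ 2)%:E < +oo -> X \in Lfun P 2%:E.
Proof.
move=> mX Xoo; rewrite inE/=; apply/andP; split; rewrite inE//=.
rewrite /finite_norm unlock poweR_lty//.
under eq_integral => w _ do
  rewrite /= powR_mulrn// real_normK ?num_real//.
exact: Xoo.
Qed.

(** Only covariances of pairs enter, which is why independence is stated for pairs in the laws of
    large numbers below. *)
Lemma variance_sum_uncorrelated (X : nat -> T -> R) n :
  (forall i, X i \in Lfun P 2%:E) ->
  (forall i j, i != j -> covariance P (X i) (X j) = 0) ->
  'V_P[(fun w => \sum_(i < n) X i w)%R] = \sum_(i < n) 'V_P[X i].
Proof.
move=> X2 X0.
have sum2 m : (fun w => \sum_(i < m) X i w)%R \in Lfun P 2%:E.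
  elim: m => [|m IH].
    rewrite (_ : (fun _ => _) = cst 0%R) ?Lfun_cst//.
    by apply/funext => w; rewrite big_ord0.
  rewrite (_ : (fun _ => _) = (fun w => \sum_(i < m) X i w)%R \+ X m)%R.
    by rewrite rpredD ?lee1n//.
  by apply/funext => w; rewrite big_ord_recr.
have cov0 m k : (m <= k)%N ->
    covariance P (fun w => \sum_(i < m) X i w)%R (X k) = 0.
  elim: m => [_|m IH mk].
    rewrite (_ : (fun _ => _) = cst 0%R) ?covariance_cst_l//.
    by apply/funext => w; rewrite big_ord0.
  rewrite (_ : (fun _ => _) = (fun w => \sum_(i < m) X i w)%R \+ X m)%R.
    by rewrite covarianceDl// IH ?(ltnW mk)// X0 ?add0e// ltn_eqF.
  by apply/funext => w; rewrite big_ord_recr.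
elim: n => [|n IH].
  rewrite (_ : (fun _ => _) = cst 0%R) ?variance_cst ?big_ord0//.
  by apply/funext => w; rewrite big_ord0.
rewrite (_ : (fun _ => _) = (fun w => \sum_(i < n) X i w)%R \+ X n)%R; last first.
  by apply/funext => w; rewrite big_ord_recr.
by rewrite varianceD// IH cov0// mule0 adde0 big_ord_recr.
Qed.

End independence.

(** * Events of vanishing probability and Markov's inequality *)

Section vanishing_events.
Context {R : realType} {d : measure_display} {T : measurableType d}.
Context (P : probability T R).
Local Open Scope ereal_scope.

(* Measurability is included because P is unconstrained on non-measurable sets. *)
Definition vanishing (B : nat -> set T) :=
  (forall n, measurable (B n)) /\
  forall e : R, (0 < e)%R -> \forall n \near \oo, P (B n) <= e%:E.

Lemma vanishingU (A B : nat -> set T) : vanishing A -> vanishing B ->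
  vanishing (fun n => A n `|` B n).
Proof.
move=> [mA vA] [mB vB]; split=> [n|e e0]; first exact: measurableU.
have e20 : (0 < e / 2)%R by rewrite divr_gt0.
near=> n; rewrite (le_trans (measureU2 _ (mA n) (mB n)))//.
rewrite (splitr e) EFinD leeD//; near: n; [exact: vA|exact: vB].
Unshelve. all: by end_near. Qed.

Lemma vanishing_le_cvg0 (B : nat -> set T) (c : nat -> R) :
  (forall n, measurable (B n)) -> c @ \oo --> (0 : R)%R ->
  (\forall n \near \oo, P (B n) <= (c n)%:E) -> vanishing B.
Proof.
move=> mB c0 Bc; split=> // e e0; near=> n.
apply: (@le_trans _ _ (c n)%:E); first by near: n.
rewrite lee_fin ltW//; near: n.
by apply: cvgr_lt c0 _ e0.
Unshelve. all: by end_near. Qed.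

(** The events [A n] are asked to be measurable only for large [n], because the coordinate formulas
    for the estimator require [0 < n]. *)
Lemma vanishing_setC_cvg1 (A B : nat -> set T) :
  (\forall n \near \oo, measurable (A n)) -> vanishing B -> (\forall n \near \oo, ~` A n `<=` B n) ->
  P (A n) @[n --> \oo] --> 1%:E.
Proof.
move=> mA [mB vB] AB.
apply/fine_cvgP; split.
  by near=> n; rewrite fin_num_measure//; near: n.
apply/cvgrPdist_le => e e0; near=> n.
have mAn : measurable (A n) by near: n.
have PA : P (~` A n) <= e%:E.
  apply: (@le_trans _ _ (P (B n))); last by near: n; exact: vB.
  rewrite le_measure ?inE//; first exact: measurableC.
  by near: n.
have PAf : P (A n) \is a fin_num by rewrite fin_num_measure.
move: PA; rewrite probability_setC// -(fineK PAf) lee_fin /=.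
have : (fine (P (A n)) <= 1)%R by rewrite -lee_fin fineK// probability_le1.
by move=> h1 h2; rewrite ger0_norm// subr_ge0.
Unshelve. all: by end_near. Qed.

Lemma measurable_event_lee (F : T -> \bar R) (a : \bar R) :
  measurable_fun setT F -> measurable [set w | a <= F w].
Proof.
by move=> mF; rewrite -[X in measurable X]setTI; exact: emeasurable_fun_c_infty.
Qed.

Lemma ge0_markov (F : T -> \bar R) (a : R) : measurable_fun setT F ->
  (forall w, 0 <= F w) -> (0 < a)%R ->
  P [set w | a%:E <= F w] <= (a^-1)%:E * \int[P]_w F w.
Proof.
move=> mF F0 a0.
have := le_integral_abse P measurableT mF a0.
rewrite setTI.
under eq_integral => w _ do rewrite gee0_abs//.
rewrite (_ : [set x | a%:E <= `|F x|] = [set w | a%:E <= F w]); last first.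
  by apply/seteqP; split => w /=; rewrite gee0_abs.
by move=> h; rewrite muleC lee_pdivlMr// muleC.
Qed.

End vanishing_events.

Lemma measurable_nneseries {R : realType} {d : measure_display}
    {T : measurableType d} (h : nat -> T -> \bar R) :
  (forall k w, (0 <= h k w)%E) -> (forall k, measurable_fun setT (h k)) ->
  measurable_fun setT (fun w => \sum_(0 <= k <oo) h k w)%E.
Proof.
move=> h0 mh.
have := @ge0_emeasurable_sum _ _ _ setT h xpredT (fun k x _ _ => h0 k x) (fun k _ => mh k).
by [].
Qed.

(** * Series of nonnegative terms and their partial sums *)

Section series_bounds.
Context {R : realType}.
Local Open Scope ereal_scope.

(** A tail is a finite sum over all [j < m] whose terms below [k] are replaced by 0, so that head,
    middle and tail can later be compared term by term in one sum. Together with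
    [partial_le_nneseries] it translates between extended-real series and real sums. *)
Lemma nneseries_le_partial (f : nat -> R) (B : R) k :
  (forall j, (0 <= f j)%R) -> (forall m, (\sum_(j < m) (if (k <= j)%N then f j else 0) <= B)%R) ->
  \sum_(k <= j <oo) (f j)%:E <= B%:E.
Proof.
move=> f0 fB; apply: lime_le.
  by apply: is_cvg_nneseries => j _ _; rewrite lee_fin.
apply: nearW => m; rewrite sumEFin lee_fin; apply: le_trans (fB m).
rewrite -(big_mkord xpredT (fun j => if (k <= j)%N then f j else 0%R)).
have [km|mk] := leqP k m.
  rewrite [leRHS](big_cat_nat (leq0n k) km)/= [X in (_ <= X + _)%R]big1_seq ?add0r; last first.
    by move=> j; rewrite mem_index_iota => /andP[_ /andP[_ jk]]; rewrite leqNgt jk.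
  rewrite le_eqVlt; apply/orP; left; apply/eqP.
  by apply: eq_big_nat => j /andP[->].
by rewrite [leLHS]big_geq ?(ltnW mk)// sumr_ge0// => j _; case: ifP.
Qed.

Lemma partial_le_nneseries (f : nat -> R) (B : R) k m :
  (forall j, (0 <= f j)%R) -> \sum_(k <= j <oo) (f j)%:E <= B%:E ->
  (\sum_(j < m) (if (k <= j)%N then f j else 0) <= B)%R.
Proof.
move=> f0 fB; rewrite -lee_fin; apply: le_trans fB.
apply: le_trans (nneseries_lim_ge m _); last by move=> j _ _; rewrite lee_fin.
rewrite sumEFin lee_fin.
rewrite -(big_mkord xpredT (fun j => if (k <= j)%N then f j else 0%R)).
have [km|mk] := leqP k m.
  rewrite [leLHS](big_cat_nat (leq0n k) km)/= [X in (X + _ <= _)%R]big1_seq ?add0r; last first.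
    by move=> j; rewrite mem_index_iota => /andP[_ /andP[_ jk]]; rewrite leqNgt jk.
  rewrite le_eqVlt; apply/orP; left; apply/eqP.
  by apply: eq_big_nat => j /andP[->].
rewrite [leRHS]big_geq ?(ltnW mk)// big1_seq// => j.
rewrite mem_index_iota => /andP[_ /andP[_ jm]].
by rewrite leqNgt (ltn_trans jm mk).
Qed.

End series_bounds.

(** * Truncation of a nonnegative integrable variable *)

Section truncation.
Context {R : realType} {d : measure_display} {T : measurableType d}.
Context (P : probability T R).
Local Open Scope ereal_scope.

(** The bounded part is always real; at [x = +oo] it equals [M] and the excess carries the infinite
    value. *)
Lemma truncation_decomp (x : \bar R) (M : R) : 0 <= x -> (0 <= M)%R ->
  x = (fine (mine x M%:E))%:E + maxe (x - M%:E) 0.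
Proof.
move=> x0 M0; case: x x0 => [r r0|_|//].
  rewrite -EFin_min /= -EFinB -EFin_max -EFinD; congr _%:E.
  by case: (leP r M) => rM; case: (leP (r - M)%R 0%R) => ?; lra.
by rewrite min_r ?leey//= addye// max_l ?leey// addey.
Qed.

(** By monotone convergence the integrals of min(W, n) tend to the finite integral of [W]; the
    integral of the excess is the difference. *)
Lemma integral_truncation_tail (W : T -> \bar R) (e : R) :
  measurable_fun setT W -> (forall w, 0 <= W w) -> \int[P]_w W w < +oo ->
  (0 < e)%R ->
  exists M : R, (0 <= M)%R /\ \int[P]_w maxe (W w - M%:E) 0 <= e%:E.
Proof.
move=> mW W0 Woo e0.
pose g (n : nat) w := mine (W w) n%:R%:E.
have mg n : measurable_fun setT (g n) by apply: measurable_mine.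
have g0 n w : 0 <= g n w by rewrite le_min W0 lee_fin ler0n.
have ndg w : {homo g^~ w : a b / (a <= b)%N >-> a <= b}.
  move=> a b ab; rewrite /g le_min ge_min lexx/= ge_min.
  by rewrite lee_fin ler_nat ab orbT.
have cg := @cvg_monotone_convergence _ _ _ P setT measurableT g
  (fun n => mg n) (fun n w _ => g0 n w) (fun w _ => ndg w).
(* Where [W] is finite the truncations are eventually constant; where it is infinite they equal
   [n]. *)
have gW w : limn (g^~ w) = W w.
  apply/cvg_lim => //.
  have := W0 w; rewrite /g; case: (W w) => [r r0|_|//].
    apply: cvg_near_cst.
    near=> n; rewrite min_l// lee_fin ltW//.
    by near: n; exact: nbhs_infty_gtr.
  under eq_fun do rewrite min_r ?leey//.
  by apply/cvgenyP.
have gWi : \int[P]_w limn (g^~ w) = \int[P]_w W w.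
  by apply: eq_integral => w _; rewrite gW.
move: cg; rewrite gWi.
have fW : \int[P]_w W w \is a fin_num.
  by rewrite ge0_fin_numE// integral_ge0.
rewrite -(fineK fW) => /fine_cvgP[_ cg'].
have /cvgrPdist_le /(_ e e0)[N _ /(_ N (leqnn N))] := cg'.
rewrite /= => hN; exists N%:R; split => //.
have D : \int[P]_w W w = \int[P]_w g N w + \int[P]_w maxe (W w - N%:R%:E) 0.
  rewrite -ge0_integralD//.
  - apply: eq_integral => w _; rewrite {1}(truncation_decomp (W w) N%:R)//.
    rewrite fineK//; apply/fin_numPlt/andP; split.
      by apply: lt_le_trans (g0 N w); rewrite ltNye.
    by rewrite gt_min ltry orbT.
  - by move=> w _; rewrite le_max lexx orbT.
  - exact: (measurable_maxe (emeasurable_funB mW (measurable_cst _)) (measurable_cst _)).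
have h0 : 0 <= \int[P]_w maxe (W w - N%:R%:E) 0.
  by apply: integral_ge0 => w _; rewrite le_max lexx orbT.
have gfin : \int[P]_w g N w \is a fin_num.
  rewrite ge0_fin_numE; last by apply: integral_ge0 => w _; exact: g0.
  by apply: le_lt_trans Woo; rewrite D leeDl.
have hfin : \int[P]_w maxe (W w - N%:R%:E) 0 \is a fin_num.
  rewrite ge0_fin_numE//.
  apply: le_lt_trans Woo; rewrite D leeDr//.
  by apply: integral_ge0 => w _; exact: g0.
move: hN; rewrite D fineD// addrAC subrr add0r.
by rewrite ger0_norm ?fine_ge0// -lee_fin fineK.
Unshelve. all: by end_near. Qed.

End truncation.

(** * Second moments and weak laws for pairwise independent, identically distributed variables *)

Section iid.
Context {R : realType} {d d' : measure_display} {T : measurableType d}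
  {S : measurableType d'}.
Context (P : probability T R) (Z : nat -> T -> S).
Hypothesis mZ : forall i, measurable_fun setT (Z i).
Local Open Scope ereal_scope.
Hypothesis Zindep : forall i k U V, i != k -> measurable U -> measurable V ->
  P (Z i @^-1` U `&` Z k @^-1` V) = P (Z i @^-1` U) * P (Z k @^-1` V).
Hypothesis Zident : forall i U, measurable U ->
  P (Z i @^-1` U) = P (Z 0%N @^-1` U).

Lemma ident_ge0_integral i (f : S -> \bar R) : measurable_fun setT f ->
  (forall x, 0 <= f x) -> \int[P]_w f (Z i w) = \int[P]_w f (Z 0%N w).
Proof.
move=> mf f0.
have E k : \int[pushforward P (Z k)]_x f x = \int[P]_w f (Z k w).
  by rewrite ge0_integral_pushforward.
rewrite -!E; apply: eq_measure_integral => U mU _.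
exact: Zident.
Qed.

Lemma ident_integral i (f : S -> \bar R) : measurable_fun setT f ->
  \int[P]_w f (Z i w) = \int[P]_w f (Z 0%N w).
Proof.
move=> mf; rewrite integralE [RHS]integralE.
have cp k : (fun w => f (Z k w))^\+ = f^\+ \o Z k.
  by apply/funext => w; rewrite -(funepos_comp f).
have cn k : (fun w => f (Z k w))^\- = f^\- \o Z k.
  by apply/funext => w; rewrite -(funeneg_comp f).
rewrite !cp !cn; congr (_ - _).
  by apply: (ident_ge0_integral i (f^\+)) => //; exact: measurable_funepos.
by apply: (ident_ge0_integral i (f^\-)) => //; exact: measurable_funeneg.
Qed.

Lemma iid_variance_sum (f : S -> R) n : measurable_fun setT f ->
  \int[P]_w (f (Z 0%N w) ^+ 2)%:E < +oo ->
  'V_P[(fun w => \sum_(i < n) f (Z i w))%R] = n%:R%:E * 'V_P[f \o Z 0%N].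
Proof.
move=> mf foo.
have mfZ i : measurable_fun setT (f \o Z i) by exact: measurableT_comp.
have fZ2 i : f \o Z i \in Lfun P 2%:E.
  apply: measurable_sqr_Lfun2 => //=.
  rewrite (ident_integral i (fun x => (f x ^+ 2)%:E))//.
  apply/measurable_EFinP; exact: measurable_funX.
have fZ1 i : f \o Z i \in Lfun P 1 by rewrite Lfun_subset12 ?fin_num_measure.
have EE i : 'E_P[f \o Z i] = 'E_P[f \o Z 0%N].
  rewrite unlock; apply: (ident_integral i (EFin \o f)).
  exact/measurable_EFinP.
rewrite (variance_sum_uncorrelated P (fun i => f \o Z i))//; last first.
  move=> i j ij.
  have ff1 : ((f \o Z i) \* (f \o Z j))%R \in Lfun P 1 by exact: Lfun2_mul_Lfun1.
  rewrite covarianceE//.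
  have iXY : indep_rv P (f \o Z i) (f \o Z j).
    move=> U V mU mV.
    have mfU W : measurable W -> measurable (f @^-1` W).
      by move=> mW; rewrite -[X in measurable X]setTI; exact: mf.
    exact: (Zindep _ _ _ _ ij (mfU _ mU) (mfU _ mV)).
  have := @indep_expectation_mul R d T P _ _ (mfZ i) (mfZ j) iXY (fZ1 i) (fZ1 j) ff1.
  move=> ->.
  by rewrite subee// fin_numM ?expectation_fin_num.
transitivity (\sum_(i < n) 'V_P[f \o Z 0%N]).
  apply: eq_bigr => i _.
  rewrite !varianceE// EE; congr (_ - _).
  rewrite unlock; apply: (ident_integral i (fun x => (f x ^+ 2)%:E)).
  by apply/measurable_EFinP; exact: measurable_funX.
rewrite -(fineK (variance_fin_num (fZ2 0%N))) sumEFin sumr_const card_ord.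
by rewrite -EFinM mulr_natl.
Qed.

Lemma measurable_sum_comp (f : S -> R) n : measurable_fun setT f ->
  measurable_fun setT (fun w => \sum_(i < n) f (Z i w))%R.
Proof.
move=> mf; apply: measurable_sum => i.
exact: (measurableT_comp mf (mZ i)).
Qed.

(** The second moment of a centred sum is its variance, which is [n] times a single variance;
    dividing by n^2 leaves 1/n. This is the source of the factor 1/n in all noise bounds. *)
Lemma iid_mean_sq (f : S -> R) n : (0 < n)%N -> measurable_fun setT f ->
  \int[P]_w (f (Z 0%N w) ^+ 2)%:E < +oo ->
  \int[P]_w (f (Z 0%N w))%:E = 0 ->
  \int[P]_w ((n%:R^-1 * \sum_(i < n) f (Z i w)) ^+ 2)%:E =
    (n%:R^-1)%:E * \int[P]_w (f (Z 0%N w) ^+ 2)%:E.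
Proof.
move=> n0 mf foo f0.
have V := iid_variance_sum f n mf foo.
have f2 i : f \o Z i \in Lfun P 2%:E.
  apply: measurable_sqr_Lfun2; first exact: measurableT_comp.
  rewrite (ident_integral i (fun x => (f x ^+ 2)%:E))//.
  by apply/measurable_EFinP; exact: measurable_funX.
have f1 i : f \o Z i \in Lfun P 1 by rewrite Lfun_subset12 ?fin_num_measure.
have E0 i : 'E_P[f \o Z i] = 0.
  rewrite unlock.
  rewrite (ident_integral i (EFin \o f))//.
  exact/measurable_EFinP.
have S2 m : (fun w => \sum_(i < m) f (Z i w))%R \in Lfun P 2%:E /\
   'E_P[(fun w => \sum_(i < m) f (Z i w))%R] = 0.
  elim: m => [|m [IH1 IH2]].
    rewrite (_ : (fun _ => _) = cst 0%R) ?Lfun_cst ?expectation_cst//.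
    by apply/funext => w; rewrite big_ord0.
  rewrite (_ : (fun _ => _) = (fun w => \sum_(i < m) f (Z i w)) \+ (f \o Z m))%R.
    split; first by rewrite rpredD ?lee1n.
    rewrite expectationD//; last by rewrite Lfun_subset12 ?fin_num_measure.
    by rewrite IH2 E0 adde0.
  by apply/funext => w; rewrite big_ord_recr.
move: V; rewrite !varianceE//; last exact: (S2 n).1.
rewrite (S2 n).2 E0 expe2 mule0 sube0 sube0 unlock => V.
have -> : (fun w => ((n%:R^-1 * \sum_(i < n) f (Z i w)) ^+ 2)%:E) =
    (fun w => ((n%:R ^+ 2)^-1)%:E * ((\sum_(i < n) f (Z i w)) ^+ 2)%:E).
  by apply/funext => w; rewrite exprMn EFinM exprVn.
have mS : measurable_fun setT (fun w => ((\sum_(i < n) f (Z i w)) ^+ 2)%:E).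
  by apply/measurable_EFinP/measurable_funX; exact: measurable_sum_comp.
have n20 : (0 <= (n%:R ^+ 2)^-1 :> R)%R by rewrite invr_ge0 exprn_ge0.
rewrite (ge0_integralZl_EFin P measurableT _ mS n20); last first.
  by move=> w _; rewrite lee_fin sqr_ge0.
have -> : \int[P]_w ((\sum_(i < n) f (Z i w)) ^+ 2)%:E =
   n%:R%:E * \int[P]_x (f (Z 0 x) ^+ 2)%:E by exact: V.
rewrite muleA -EFinM; congr (_%:E * _).
by rewrite expr2 invfM -mulrA mulVf ?mulr1// pnatr_eq0 -lt0n.
Qed.

(** Chebyshev's inequality: the centred variable stays within [M] in absolute value, so the
    probability is at most M^2 / (e^2 n). The deviation is squared to fit the second moment computed
    above. *)
Lemma weak_law_bounded (g : S -> R) (M e : R) : measurable_fun setT g ->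
  (forall x, 0 <= g x <= M)%R -> (0 < e)%R ->
  vanishing P (fun n => [set w | (e ^+ 2)%:E <=
    ((n%:R^-1 * \sum_(i < n) (g (Z i w) - fine (\int[P]_w (g (Z 0%N w))%:E))) ^+ 2)%:E]).
Proof.
move=> mg gM e0.
set m := fine _; pose f x := (g x - m)%R.
have mf : measurable_fun setT f by exact: measurable_funB.
have M0 : (0 <= M)%R by case/andP : (gM (Z 0%N point)) => a b; exact: le_trans b.
have mgZ : measurable_fun setT (g \o Z 0%N) by exact: measurableT_comp.
have ig : P.-integrable setT (EFin \o (g \o Z 0%N)).
  apply: (@le_integrable _ _ _ P setT measurableT _ (EFin \o cst M)).
  - exact/measurable_EFinP.
  - move=> w _ /=; rewrite lee_fin; have /andP[a b] := gM (Z 0%N w).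
    by rewrite !ger0_norm.
  - exact: finite_measure_integrable_cst.
have m01 : (0 <= m <= M)%R.
  apply/andP; split.
    by apply: fine_ge0; apply: integral_ge0 => w _; rewrite lee_fin; case/andP: (gM (Z 0%N w)).
  rewrite -lee_fin fineK; last exact: integrable_fin_num ig.
  apply: (@le_trans _ _ (\int[P]_w (cst M%:E w))).
    apply: ge0_le_integral => //.
    - by move=> w _; rewrite lee_fin; case/andP: (gM (Z 0%N w)).
    - exact/measurable_EFinP.
    - by move=> w _; rewrite lee_fin; case/andP: (gM (Z 0%N w)).
  by rewrite integral_cst//= probability_setT mule1.
have fM x : (f x ^+ 2 <= M ^+ 2)%R.
  have /andP[a b] := gM x; have /andP[a' b'] := m01.
  rewrite -ler_sqrt ?exprn_ge0// !sqrtr_sqr (ger0_norm M0) ler_norml /f; lra.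
have foo : \int[P]_w (f (Z 0%N w) ^+ 2)%:E <= (M ^+ 2)%:E.
  apply: (@le_trans _ _ (\int[P]_w (cst (M ^+ 2)%:E w))).
    apply: ge0_le_integral => //.
    - by move=> w _; rewrite lee_fin sqr_ge0.
    - by apply/measurable_EFinP/measurable_funX; exact: measurableT_comp.
    - by move=> w _; rewrite lee_fin.
  by rewrite integral_cst//= probability_setT mule1.
have f0 : \int[P]_w (f (Z 0%N w))%:E = 0.
  transitivity (\int[P]_w ((g (Z 0%N w))%:E - (cst m%:E) w)).
    by apply: eq_integral => w _; rewrite EFinB.
  rewrite integralB//; last exact: finite_measure_integrable_cst.
  rewrite integral_cst//= probability_setT mule1 /m fineK; last exact: integrable_fin_num ig.
  by rewrite subee//; exact: integrable_fin_num ig.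
have mF n : measurable_fun setT (fun w => ((n%:R^-1 * \sum_(i < n) f (Z i w)) ^+ 2)%:E).
  apply/measurable_EFinP/measurable_funX/measurable_funM => //.
  exact: measurable_sum_comp.
apply: (@vanishing_le_cvg0 _ _ _ P _ (fun n => (e ^+ 2)^-1 * M ^+ 2 * n%:R^-1)%R).
- move=> n; exact: measurable_event_lee.
- rewrite -[X in _ --> X](mulr0 ((e ^+ 2)^-1 * M ^+ 2)%R); apply: cvgMr.
  rewrite gtr0_cvgV0; first exact: cvgr_idn.
  by near=> n; rewrite ltr0n; near: n; exact: nbhs_infty_gt.
- near=> n.
  have n0 : (0 < n)%N by near: n; exact: nbhs_infty_gt.
  apply: le_trans (ge0_markov P _ (e ^+ 2)%R (mF n) _ _) _.
  + by move=> w; rewrite lee_fin sqr_ge0.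
  + by rewrite exprn_gt0.
  + rewrite iid_mean_sq//; last by apply: le_lt_trans foo _; rewrite ltry.
    rewrite -mulrA EFinM lee_pmul2l//; last by rewrite lte_fin invr_gt0 exprn_gt0.
    by rewrite muleC EFinM lee_wpmul2r// lee_fin.
Unshelve. all: by end_near. Qed.

(** The margin 2 above the mean is spent in two units: one for the average of the truncated
    variables exceeding its mean, one for the average of the excesses. The truncation level depends
    on the tolerance [e] while the event does not, so the definition of [vanishing] is proved
    directly, without an explicit rate. *)
Lemma weak_law_upper (W : S -> \bar R) : measurable_fun setT W ->
  (forall x, 0 <= W x) -> \int[P]_w W (Z 0%N w) < +oo ->
  vanishing P (fun n => [set w |
    (n%:R * (fine (\int[P]_w W (Z 0%N w)) + 2))%:E <= \sum_(i < n) W (Z i w)]).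
Proof.
move=> mW W0 Woo.
have mWZ i : measurable_fun setT (W \o Z i) by exact: measurableT_comp.
split=> [n|e e0].
  apply: measurable_event_lee; apply: emeasurable_sum => i; exact: mWZ.
have e20 : (0 < e / 2)%R by rewrite divr_gt0.
have [M [M0 hM]] := integral_truncation_tail P (W \o Z 0%N) (e / 2)%R (mWZ 0%N)
  (fun w => W0 _) Woo e20.
pose g x := fine (mine (W x) M%:E); pose h x := maxe (W x - M%:E) 0.
have gb x : (0 <= g x <= M)%R.
  rewrite /g; have := W0 x; case: (W x) => [r r0|_|//].
    by rewrite -EFin_min /= le_min ge_min lexx orbT andbT M0 -lee_fin r0.
  by rewrite min_r ?leey//= M0 lexx.
have mg : measurable_fun setT g.
  apply: (measurableT_comp (fine_measurable measurableT)).
  by apply: measurable_mine.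
have mh : measurable_fun setT h.
  exact: (measurable_maxe (emeasurable_funB mW (measurable_cst _)) (measurable_cst _)).
have h0 x : 0 <= h x by rewrite le_max lexx orbT.
pose m := fine (\int[P]_w (g (Z 0%N w))%:E).
pose A n := [set w | (1 ^+ 2)%:E <=
  ((n%:R^-1 * \sum_(i < n) (g (Z i w) - m)) ^+ 2)%:E].
have [mA vA] : vanishing P A.
  exact: (weak_law_bounded g M 1%R mg gb ltr01).
set c := fine (\int[P]_w W (Z 0%N w)).
have mc : (m <= c)%R.
  apply: fine_le.
  - rewrite ge0_fin_numE; last by apply: integral_ge0 => w _; rewrite lee_fin; case/andP: (gb (Z 0%N w)).
    apply: le_lt_trans Woo; apply: ge0_le_integral => //.
    + by move=> w _; rewrite lee_fin; case/andP: (gb (Z 0%N w)).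
    + by apply/measurable_EFinP; exact: (measurableT_comp mg).
    + exact: mWZ.
    + by move=> w _; rewrite [leRHS](truncation_decomp _ M)// leeDl// h0.
  - by rewrite ge0_fin_numE// integral_ge0.
  - apply: ge0_le_integral => //.
    + by move=> w _; rewrite lee_fin; case/andP: (gb (Z 0%N w)).
    + by apply/measurable_EFinP; exact: (measurableT_comp mg).
    + exact: mWZ.
    + by move=> w _; rewrite [leRHS](truncation_decomp _ M)// leeDl// h0.
pose C n := [set w | n%:R%:E <= \sum_(i < n) h (Z i w)].
have mhs n : measurable_fun setT (fun w => \sum_(i < n) h (Z i w)).
  by apply: emeasurable_sum => i; exact: (measurableT_comp mh (mZ i)).
have mC n : measurable (C n) by exact: measurable_event_lee.
near=> n.
have n0 : (0 < n)%N by near: n; exact: nbhs_infty_gt.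
have nR0 : (0 < n%:R :> R)%R by rewrite ltr0n.
apply: (@le_trans _ _ (P (A n `|` C n))).
  rewrite le_measure ?inE//.
  - apply: measurable_event_lee; apply: emeasurable_sum => i; exact: mWZ.
  - exact: measurableU.
  (* Off both events the bounded parts sum to less than n (m + 1) and the excesses to less than
     n. *)
  move=> w /= WB; apply: contrapT => /not_orP[nA nC].
  move/negP : nC; rewrite -ltNge => nC.
  move/negP : nA; rewrite /A /= -ltNge lte_fin => nA.
  have sg : (\sum_(i < n) g (Z i w) < n%:R * (m + 1))%R.
    have nA1 : (n%:R^-1 * \sum_(i < n) (g (Z i w) - m) < 1)%R.
      rewrite ltNge; apply/negP => h1; move: nA; rewrite ltNge => /negP; apply.
      by rewrite lerXn2r ?nnegrE ?(le_trans _ h1).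
    move: nA1; rewrite ltr_pdivrMl// mulr1 sumrB sumr_const card_ord -mulr_natl.
    by rewrite mulrDr mulr1 => ?; lra.
  have : \sum_(i < n) W (Z i w) < (n%:R * (c + 2))%:E.
    rewrite (eq_bigr (fun i : 'I_n => (g (Z i w))%:E + h (Z i w))); last first.
      by move=> i _; exact: truncation_decomp.
    rewrite big_split /= sumEFin.
    apply: (@lt_le_trans _ _ ((n%:R * (m + 1))%:E + n%:R%:E)).
      by apply: lteD; rewrite // lte_fin.
    rewrite -EFinD lee_fin; nra.
  by rewrite ltNge WB.
rewrite (le_trans (measureU2 _ (mA n) (mC n)))// (splitr e) EFinD leeD//.
  by near: n; exact: vA.
(* The [n] equal expectations of the excess cancel against the threshold [n]. *)
apply: le_trans (ge0_markov P _ n%:R (mhs n) _ nR0) _.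
  by move=> w; apply: sume_ge0 => i _.
rewrite ge0_integral_sum//; last first.
  by move=> i; exact: (measurableT_comp mh (mZ i)).
apply: le_trans hM.
rewrite (eq_bigr (fun i : 'I_n => \int[P]_w h (Z 0%N w))); last first.
  by move=> i _; rewrite (ident_integral i h).
have hfin : \int[P]_w h (Z 0%N w) \is a fin_num.
  rewrite ge0_fin_numE; last by apply: integral_ge0 => w _.
  apply: le_lt_trans Woo; apply: ge0_le_integral => //.
  - exact: (measurableT_comp mh (mZ 0%N)).
  - exact: mWZ.
  - move=> w _; rewrite [leRHS](truncation_decomp _ M)// leeDr// lee_fin.
    by case/andP: (gb (Z 0%N w)).
rewrite -/(h _) -(fineK hfin) sumEFin -EFinM sumr_const card_ord.
by rewrite -(mulr_natl (fine _)) mulKf// gt_eqF.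
Unshelve. all: by end_near. Qed.

(** Markov's inequality for the whole series, after exchanging sum and integral. The weights [a n]
    and the threshold [th n] may both move with [n], as the cutoff does; only the ratio [c n] of
    expected value to threshold must tend to 0. *)
Lemma weighted_mean_sq_vanishing (f : nat -> S -> R) (v : nat -> R)
    (a : nat -> nat -> R) (th c : nat -> R) :
  (forall j, measurable_fun setT (f j)) ->
  (forall j, \int[P]_w (f j (Z 0%N w))%:E = 0) ->
  (forall j, \int[P]_w (f j (Z 0%N w) ^+ 2)%:E <= (v j)%:E) ->
  (forall n j, (0 <= a n j)%R) ->
  c @ \oo --> (0 : R)%R ->
  (forall n, (0 < n)%N -> (0 < th n)%R /\
    forall m, (\sum_(j < m) a n j * v j / n%:R <= c n * th n)%R) ->
  vanishing P (fun n => [set w | (th n)%:E <= \sum_(0 <= j <oo)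
    (a n j * (n%:R^-1 * \sum_(i < n) f j (Z i w)) ^+ 2)%:E]).
Proof.
move=> mf f0 fv a0 c0 H.
have me n j : measurable_fun setT (fun w => ((n%:R^-1 * \sum_(i < n) f j (Z i w)) ^+ 2)%:E).
  apply/measurable_EFinP/measurable_funX/measurable_funM => //.
  by apply: (measurable_sum_comp (f j)).
have mae n j : measurable_fun setT
    (fun w => (a n j * (n%:R^-1 * \sum_(i < n) f j (Z i w)) ^+ 2)%:E).
  apply/measurable_EFinP/measurable_funM => //.
  by apply/measurable_EFinP; exact: me.
have mF n : measurable_fun setT (fun w => \sum_(0 <= j <oo)
    (a n j * (n%:R^-1 * \sum_(i < n) f j (Z i w)) ^+ 2)%:E).
  apply: (measurable_nneseries (fun j w =>
    (a n j * (n%:R^-1 * \sum_(i < n) f j (Z i w)) ^+ 2)%:E)) => [j w|j] //.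
  by rewrite lee_fin mulr_ge0 ?sqr_ge0.
apply: (@vanishing_le_cvg0 _ _ _ P _ c) => //.
  by move=> n; exact: measurable_event_lee.
near=> n.
have n0 : (0 < n)%N by near: n; exact: nbhs_infty_gt.
have [th0 Hn] := H n n0.
apply: le_trans (ge0_markov P _ (th n) (mF n) _ th0) _.
  by move=> w; apply: nneseries_ge0 => j _ _; rewrite lee_fin mulr_ge0 ?sqr_ge0.
rewrite lee_pdivrMl// -EFinM mulrC.
rewrite integral_nneseries//; last by move=> j w _; rewrite lee_fin mulr_ge0 ?sqr_ge0.
apply: (@le_trans _ _ (\sum_(0 <= j <oo) (a n j * v j / n%:R)%:E)).
  apply: lee_nneseries => [j _ _|j _].
    by apply: integral_ge0 => w _; rewrite lee_fin mulr_ge0 ?sqr_ge0.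
  under eq_integral do rewrite EFinM.
  rewrite ge0_integralZl_EFin//; last by move=> w _; rewrite lee_fin sqr_ge0.
  rewrite iid_mean_sq//; last first.
    by apply: le_lt_trans (fv j) _; rewrite ltry.
  rewrite -mulrA EFinM lee_wpmul2l ?lee_fin// mulrC EFinM.
  by rewrite lee_wpmul2l ?lee_fin ?invr_ge0 ?ler0n.
apply: nneseries_le_partial => [j|m /=]; last exact: Hn.
have v0 : (0 <= v j)%R.
  rewrite -lee_fin; apply: le_trans (fv j).
  by apply: integral_ge0 => w _; rewrite lee_fin sqr_ge0.
by rewrite !mulr_ge0 ?invr_ge0.
Unshelve. all: by end_near. Qed.

End iid.

(** If the capped square had integral 0 it would vanish almost everywhere, and then so would the
    square, since min(t, 1) = 0 forces t = 0. *)
Lemma integral_min_sqr_gt0 {R : realType} {d : measure_display}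
    {T : measurableType d} (P : probability T R) (f : T -> R) :
  measurable_fun setT f -> (0 < \int[P]_w (f w ^+ 2)%:E)%E ->
  (0 < \int[P]_w (Num.min (f w ^+ 2) 1)%:E)%E.
Proof.
move=> mf fpos.
have g0 w : (0 <= (Num.min (f w ^+ 2) 1)%:E)%E by rewrite lee_fin le_min sqr_ge0 ler01.
have mf2 : measurable_fun setT (fun w => (f w ^+ 2)%:E).
  by apply/measurable_EFinP; exact: measurable_funX.
have mg : measurable_fun setT (fun w => (Num.min (f w ^+ 2) 1)%:E).
  by apply/measurable_EFinP/measurable_minr => //; exact: measurable_funX.
rewrite lt0e integral_ge0// andbT; apply/eqP => gi0.
have : (\int[P]_w `|(Num.min (f w ^+ 2) 1)%:E| = 0)%E.
  by under eq_integral do rewrite gee0_abs//.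
move=> /(ae_eq_integral_abs P measurableT mg) g0ae.
suff f20 : (\int[P]_w (f w ^+ 2)%:E = \int[P]_w (cst 0 w))%E.
  by move: fpos; rewrite f20 integral0 ltxx.
apply: ge0_ae_eq_integral => //.
  by move=> w _; rewrite lee_fin sqr_ge0.
apply: filterS g0ae => w /= h _; have {h} [h] := h I; congr _%:E; move: h.
by rewrite minEle; case: ifP => // _ /eqP; rewrite oner_eq0.
Qed.

(** * Pairwise independence from mutual independence *)

Section borel_iid.
Context {R : realType} {d : measure_display} {T : measurableType d}.
Context (P : probability T R) {Y : normedModType R} (Yr : nat -> T -> Y).

Lemma mutually_independent_pair i k (U V : set Y) :
  mutually_independent P Yr -> i != k -> borel_sets U -> borel_sets V ->
  P (Yr i @^-1` U `&` Yr k @^-1` V) = (P (Yr i @^-1` U) * P (Yr k @^-1` V))%E.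
Proof.
move=> indep ik bU bV.
have := indep [:: i; k] (fun l => if l == i then U else V).
rewrite /= inE ik => /(_ isT); rewrite big_cons big_seq1 eqxx.
rewrite (eq_sym k i) (negbTE ik) => H; rewrite -H; last first.
  by move=> l; rewrite !inE; case: eqP.
congr (P _); apply/seteqP; split => w /=.
  move=> [Uw Vw] l /=; rewrite !inE => /orP[/eqP ->|/eqP ->].
    by rewrite eqxx.
  by rewrite (eq_sym k i) (negbTE ik).
move=> H'; split.
  by have := H' i; rewrite /= !inE !eqxx => /(_ isT).
by have := H' k; rewrite /= !inE !eqxx orbT (eq_sym k i) (negbTE ik) => /(_ isT).
Qed.

End borel_iid.

(** * Hilbert space geometry *)

Section inner_product_theory.
Context {R : realType} {V : normedModType R} (ipV : inner_product V).
Local Notation "<| x , y |>" := (ip ipV x y) (at level 0, format "<| x ,  y |>").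
Implicit Types x y z : V.

Lemma ip0l z : <|0, z|> = 0.
Proof.
have := ip_linl ipV 1 0 0 z.
by rewrite scale1r addr0 mul1r => /eqP; rewrite -subr_eq subrr eq_sym => /eqP.
Qed.

Lemma ipDl x y z : <|x + y, z|> = <|x, z|> + <|y, z|>.
Proof. by rewrite -{1}(scale1r x) ip_linl mul1r. Qed.

Lemma ipZl a x z : <|a *: x, z|> = a * <|x, z|>.
Proof. by rewrite -[a *: x]addr0 ip_linl ip0l addr0. Qed.

Lemma ipBl x y z : <|x - y, z|> = <|x, z|> - <|y, z|>.
Proof. by rewrite ipDl -scaleN1r ipZl mulN1r. Qed.

Lemma ip_suml n (f : nat -> V) z : <|\sum_(i < n) f i, z|> = \sum_(i < n) <|f i, z|>.
Proof.
elim: n => [|n IH]; first by rewrite !big_ord0 ip0l.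
by rewrite !big_ord_recr/= ipDl IH.
Qed.

(** Positivity is not a field of the record and is recovered from [ip_norm]: a negative value would
    have square root 0, hence [x = 0]. *)
Lemma ipxx x : <|x, x|> = `|x| ^+ 2.
Proof.
have [x0|x0] := leP 0 <|x, x|>; first by rewrite (ip_norm ipV) sqr_sqrtr.
have : `|x| = 0 by rewrite (ip_norm ipV) ltr0_sqrtr.
by move/eqP; rewrite normr_eq0 => /eqP ->; rewrite ip0l normr0 expr0n.
Qed.

Lemma norm_addsq x y : `|x + y| ^+ 2 = `|x| ^+ 2 + 2 * <|x, y|> + `|y| ^+ 2.
Proof.
rewrite -!ipxx ipDl (ip_sym ipV x (x + y)) (ip_sym ipV y (x + y)) !ipDl (ip_sym ipV y x); ring.
Qed.

Lemma ip_polarization x y : <|x, y|> = (`|x + y| ^+ 2 - `|x| ^+ 2 - `|y| ^+ 2) / 2.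
Proof. by rewrite norm_addsq; field. Qed.

(** Polarization writes the inner product through norms, so continuity follows from that of the
    norm. *)
Lemma ip_continuous y : continuous (fun x => <|x, y|>).
Proof.
rewrite (_ : (fun _ => _) =
  fun x => (`|x + y| ^+ 2 - `|x| ^+ 2 - `|y| ^+ 2) / 2); last first.
  by apply/funext => x; exact: ip_polarization.
move=> x; apply: cvgMl; apply: cvgB; last exact: cvg_cst.
have sqrc (z : R) : (fun t : R => t ^+ 2) @ z --> z ^+ 2.
  by rewrite expr2; apply: cvgM.
apply: cvgB.
  apply: (@cvg_comp _ _ _ (fun x => `|x + y|) (fun t : R => t ^+ 2)); last exact: sqrc.
  by apply: cvg_norm; apply: cvgD => //; exact: cvg_cst.
apply: (@cvg_comp _ _ _ (fun x => `|x|) (fun t : R => t ^+ 2)); last exact: sqrc.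
exact: cvg_norm.
Qed.

Section orthonormal_family.
Variables (e : nat -> V) (eon : Defs.orthonormal ipV e).

Lemma ip_sum_orthonormal n (c : nat -> R) j :
  <|\sum_(i < n) c i *: e i, e j|> = if (j < n)%N then c j else 0.
Proof.
rewrite (ip_suml n (fun i => c i *: e i)).
under eq_bigr do rewrite ipZl eon.
case: ltnP => jn.
  rewrite (bigD1 (Ordinal jn))//= eqxx mulr1 big1 ?addr0// => i ij.
  by rewrite (_ : _ == _ = false) ?mulr0//; apply/negbTE.
by rewrite big1// => i _; rewrite ltn_eqF ?mulr0// (leq_trans _ jn).
Qed.

Lemma norm_sum_orthonormal n (c : nat -> R) :
  `|\sum_(i < n) c i *: e i| ^+ 2 = \sum_(i < n) c i ^+ 2.
Proof.
rewrite -ipxx [LHS](ip_suml n (fun i => c i *: e i)).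
by apply: eq_bigr => i _; rewrite ipZl ip_sym ip_sum_orthonormal ltn_ord expr2.
Qed.

Lemma bessel x n : \sum_(i < n) <|x, e i|> ^+ 2 <= `|x| ^+ 2.
Proof.
pose s := \sum_(i < n) <|x, e i|> *: e i.
have ss : `|s| ^+ 2 = \sum_(i < n) <|x, e i|> ^+ 2.
  exact: (norm_sum_orthonormal n (fun i => <|x, e i|>)).
have xs : <|x, s|> = \sum_(i < n) <|x, e i|> ^+ 2.
  rewrite ip_sym (ip_suml n (fun i => <|x, e i|> *: e i)).
  by apply: eq_bigr => i _; rewrite ipZl (ip_sym ipV (e i)) expr2.
have : 0 <= `|x - s| ^+ 2 by rewrite exprn_ge0.
have -> : `|x - s| ^+ 2 = `|x| ^+ 2 - 2 * <|x, s|> + `|s| ^+ 2.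
  by rewrite norm_addsq normrN (ip_sym ipV x (- s)) -scaleN1r ipZl (ip_sym ipV s); ring.
by rewrite ss xs; lra.
Qed.

(** The coefficient is constant along the partial sums once they pass [j], and the inner product is
    continuous. It serves to read off the coefficients of [yhat]. *)
Lemma ip_limit_orthonormal (c : nat -> R) x j :
  (fun n => \sum_(i < n) c i *: e i) @ \oo --> x -> <|x, e j|> = c j.
Proof.
move=> cx.
have h1 : (fun n => <|\sum_(i < n) c i *: e i, e j|>) @ \oo --> <|x, e j|>.
  apply: (@cvg_comp _ _ _ _ (fun x => <|x, e j|>) _ _ _ cx).
  exact: ip_continuous.
have h2 : (fun n => <|\sum_(i < n) c i *: e i, e j|>) @ \oo --> c j.
  apply: cvg_near_cst; near=> n; rewrite ip_sum_orthonormal ifT//.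
  by near: n; exact: nbhs_infty_gt.
exact: (cvg_unique _ h1 h2).
Unshelve. all: by end_near. Qed.

(** A one-sided substitute for Parseval's identity. The bound is asked for large [n] only, because
    the error estimate needs partial sums reaching beyond the cutoff. *)
Lemma norm_limit_orthonormal_le (c : nat -> R) x (b : R) :
  (fun n => \sum_(i < n) c i *: e i) @ \oo --> x ->
  (\forall n \near \oo, \sum_(i < n) c i ^+ 2 <= b) -> `|x| ^+ 2 <= b.
Proof.
move=> cx cb.
have h1 : (fun n => `|\sum_(i < n) c i *: e i| ^+ 2) @ \oo --> `|x| ^+ 2.
  apply: (@cvg_comp _ _ _ (fun n => `|\sum_(i < n) c i *: e i|) (fun t : R => t ^+ 2)).
    exact: cvg_norm cx.
  by rewrite expr2; apply: cvgM.
rewrite -(cvg_lim _ h1)//; apply: limr_le; first by apply/cvg_ex; exists (`|x| ^+ 2).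
by near=> n; rewrite norm_sum_orthonormal; near: n.
Unshelve. all: by end_near. Qed.

End orthonormal_family.

(** The Borel structure on [V] is named as the sigma-algebra generated by its open sets, to match
    [borel_sets]; on the real side open intervals generate, and their preimages are open. *)
Lemma ip_measurable y :
  measurable_fun [set: g_sigma_algebraType [set A : set V | open A]]
    (fun x : g_sigma_algebraType [set A : set V | open A] => <|x, y|>).
Proof.
apply: (measurability _ (RGenOpens.measurableE R)).
move=> _ [_ [a [b ->] <-]]; rewrite setTI.
apply: sub_sigma_algebra => /=.
apply: open_comp => [x _|]; [exact: ip_continuous|exact: interval_open].
Qed.

End inner_product_theory.

(** * Power rates *)

Section power_rates.
Context {R : realType}.
Implicit Types (a x y : R) (n j : nat).

(** An integral comparison without integrals. The inequality 1 + t <= exp t is used twice: to bound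
    ln(x/(x+1)) from above, and to bound the power (x/(x+1))^(-a) from below. *)
Lemma powRN_telescope a x : 0 < a -> 0 < x ->
  a * (x + 1) `^ (- (1 + a)) <= x `^ (- a) - (x + 1) `^ (- a).
Proof.
move=> a0 x0.
have y0 : 0 < x + 1 by rewrite addr_gt0.
have xy0 : 0 < x / (x + 1) by rewrite divr_gt0.
have E : x `^ (- a) = (x + 1) `^ (- a) * (x / (x + 1)) `^ (- a).
  by rewrite -powRM ?(ltW y0) ?(ltW xy0)// mulrC divfK// gt_eqF.
have L : ln (x / (x + 1)) <= x / (x + 1) - 1.
  have := expR_ge1Dx (ln (x / (x + 1))); rewrite lnK ?posrE//; lra.
have H : 1 + a / (x + 1) <= (x / (x + 1)) `^ (- a).
  rewrite /powR gt_eqF//; apply: le_trans (expR_ge1Dx _).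
  rewrite lerD2l; have -> : a / (x + 1) = (- a) * (x / (x + 1) - 1).
    by field; rewrite gt_eqF.
  by rewrite ler_nM2l// oppr_lt0.
rewrite opprD powRD ?(gt_eqF y0) ?implybT// (powRN _ 1) powRr1 ?(ltW y0)// E.
have := ler_wpM2l (powR_ge0 (x + 1) (- a)) H.
by rewrite mulrDr mulr1 => h; rewrite lerBrDl (le_trans _ h)// lerD2l; lra.
Qed.

Lemma zeta_partial_sum_bounded a : 0 < a ->
  exists S : R, 0 < S /\ forall n, \sum_(j < n) (j.+1)%:R `^ (- (1 + a)) <= S.
Proof.
move=> a0; exists (1 + a^-1); split; first by rewrite addr_gt0// invr_gt0.
(* The induction keeps the telescoped remainder, which is dropped at the end. *)
have H n : \sum_(j < n.+1) (j.+1)%:R `^ (- (1 + a)) <=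
    1 + a^-1 - a^-1 * (n.+1)%:R `^ (- a) :> R.
  elim: n => [|n IH].
    by rewrite big_ord_recr big_ord0/= !powR1; lra.
  rewrite big_ord_recr/=.
  have := powRN_telescope a (n.+1)%:R a0 (ltr0Sn _ _).
  rewrite natr1 -ler_pdivlMl// => h; lra.
case=> [|n]; first by rewrite big_ord0 addr_ge0// invr_ge0 ltW.
apply: le_trans (H n) _; rewrite gerBl mulr_ge0// ?invr_ge0 ?(ltW a0)//.
Qed.

Lemma powRN_le a x y : 0 <= a -> 0 < x -> x <= y -> y `^ (- a) <= x `^ (- a).
Proof.
move=> a0 x0 xy; have y0 := lt_le_trans x0 xy.
rewrite !powRN lef_pV2 ?posrE ?powR_gt0//.
by rewrite ge0_ler_powR// nnegrE ltW.
Qed.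

Lemma powRN_natr_cvg0 a : 0 < a -> (fun n => n%:R `^ (- a)) @ \oo --> (0 : R).
Proof.
move=> a0; apply/cvgr0Pnorm_le => e e0; near=> n.
rewrite ger0_norm ?powR_ge0//.
have n0 : (0 < n)%N by near: n; exact: nbhs_infty_gt.
have eV : e = (e `^ (- a^-1)) `^ (- a).
  by rewrite -powRrM mulrNN mulVf ?gt_eqF// powRr1// ltW.
rewrite eV; apply: powRN_le; rewrite ?(ltW a0) ?powR_gt0// ltW//.
by near: n; exact: nbhs_infty_gtr.
Unshelve. all: by end_near. Qed.

(* The cutoff n^b balances the source condition against the noise: at j = n^b the
   product d_j sigma_j sigma_j^nu is of order n^(-1/2). *)
Lemma rate_cutoff (q p eps nu c C kappa : R) (sigma : nat -> R) :
  0 < q -> p - 1 < q -> 0 < eps -> 1 + eps < p -> 0 < nu ->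
  0 < c -> 0 < C -> 0 < kappa ->
  (forall j, 0 < sigma j) ->
  (forall j : nat, c * (j.+1)%:R `^ (- q) <= sigma j ^+ 2 <= C * (j.+1)%:R `^ (- q)) ->
  let b := (q + 1 + eps - p + q * nu)^-1 in
  exists (ks : nat -> nat) (M : R), 0 < M /\ forall n : nat, (0 < n)%N ->
  let r := n%:R `^ (- (q * nu * b)) in
  let z := n%:R `^ (- (b * (eps / 2))) in
  (forall j, (ks n <= j)%N ->
     [/\ dw p eps j ^+ 2 * sigma j ^+ 2 * (sigma j `^ nu) ^+ 2 <= kappa / n%:R,
      (sigma j `^ nu) ^+ 2 <= M * r &
      dw p eps j ^+ 2 * (j.+1)%:R `^ (- p) <= z * (j.+1)%:R `^ (- (1 + eps / 2))]) /\
  (forall j, (j < ks n)%N ->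
     sigma j ^- 2 / n%:R <= M * r * dw p eps j ^+ 2 /\
     sigma j ^- 2 * (j.+1)%:R `^ (- p) / n%:R <=
        M * (r * z) * (j.+1)%:R `^ (- (1 + eps / 2))).
Proof.
move=> q0 pq eps0 peps nu0 c0 C0 k0 s0 sC b.
(* Up to constants (sigma_j d_j)^(-2) is j^s2 and sigma_j^(2 nu) is j^(-t2), so b = 1/(s2 + t2). *)
set s2 := q + 1 + eps - p in b *; set t2 := q * nu in b *.
have s20 : 0 < s2 by rewrite /s2; lra.
have t20 : 0 < t2 by rewrite mulr_gt0.
have st0 : 0 < s2 + t2 by rewrite addr_gt0.
have b0 : 0 < b by rewrite invr_gt0.
have bst : b * (s2 + t2) = 1 by rewrite /b mulVf// gt_eqF.
pose D := C * C `^ nu.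
have D0 : 0 < D by rewrite mulr_gt0// powR_gt0.
(* The second entry makes D A^(-(s2 + t2)) at most [kappa]; the entry 1 gives A n^b >= 1, so that
   rounding up to [ks n] costs at most a factor 2. *)
pose A := Num.max 1 ((D / kappa) `^ b).
have A1 : 1 <= A by rewrite le_max lexx.
have A0 : 0 < A by rewrite (lt_le_trans ltr01).
have AD : D * A `^ (- (s2 + t2)) <= kappa.
  have Dk0 : 0 < D / kappa by rewrite divr_gt0.
  have h : A `^ (- (s2 + t2)) <= ((D / kappa) `^ b) `^ (- (s2 + t2)).
    by apply: powRN_le; rewrite ?(ltW st0) ?powR_gt0// le_max lexx orbT.
  move: h; rewrite -powRrM mulrN bst (powRN _ 1) powRr1 ?(ltW Dk0)// invf_div => h.
  by rewrite mulrC -ler_pdivlMr.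
pose ks n := (Num.truncn (A * n%:R `^ b)).+1.
(* One entry for each bound in terms of [M]: the source condition beyond the cutoff, the ratio to
   the weights below it, and the variance below it. The factor 2 A comes from the upper bound on
   [ks n]. *)
pose M := Num.max (C `^ nu)
  (Num.max (c^-1 * (2 * A) `^ s2) (c^-1 * (2 * A) `^ (s2 - eps / 2))).
have M0 : 0 < M by rewrite lt_max powR_gt0.
exists ks, M; split=> // n n0 r z.
have N0 : 0 < n%:R :> R by rewrite ltr0n.
have N1 : 1 <= n%:R :> R by rewrite ler1n.
have Nb1 : 1 <= n%:R `^ b by rewrite -[leLHS](powRr0 n%:R) ler_powR// ltW.
have kl : A * n%:R `^ b <= (ks n)%:R by rewrite ltW// truncnS_gt.
have AN1 : 1 <= A * n%:R `^ b by rewrite mulr_ege1.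
have ku : (ks n)%:R <= 2 * A * n%:R `^ b.
  have : (Num.truncn (A * n%:R `^ b))%:R <= A * n%:R `^ b.
    by rewrite truncn_le// (le_trans ler01).
  by rewrite /ks -natr1 -mulrA => h; lra.
have Ns0 : 0 < n%:R `^ b by rewrite (lt_le_trans ltr01).
have AN0 : 0 < A * n%:R `^ b by rewrite mulr_gt0.
have dwE j : dw p eps j ^+ 2 = (j.+1)%:R `^ (p - 1 - eps).
  by rewrite /dw -powR_mulrn ?powR_ge0// -powRrM divfK// pnatr_eq0.
have snu j : (sigma j `^ nu) ^+ 2 <= C `^ nu * (j.+1)%:R `^ (- t2).
  have /andP[_ h] := sC j.
  have -> : (sigma j `^ nu) ^+ 2 = (sigma j ^+ 2) `^ nu.
    rewrite -powR_mulrn ?powR_ge0// -powRrM mulrC powRrM.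
    by rewrite powR_mulrn// ltW.
  rewrite /t2 -mulNr powRrM -powRM ?powR_ge0 ?(ltW C0)//.
  by rewrite ge0_ler_powR ?nnegrE ?(ltW nu0) ?sqr_ge0 ?mulr_ge0 ?powR_ge0 ?(ltW C0).
have J0 j : 0 < (j.+1)%:R :> R by rewrite ltr0n.
have Jadd j (x y : R) : (j.+1)%:R `^ (x + y) = (j.+1)%:R `^ x * (j.+1)%:R `^ y :> R.
  by rewrite powRD// pnatr_eq0 implybT.
have Nadd (x y : R) : n%:R `^ (x + y) = n%:R `^ x * n%:R `^ y :> R.
  by rewrite powRD// pnatr_eq0 -lt0n n0 implybT.
have sinv j : sigma j ^- 2 <= c^-1 * (j.+1)%:R `^ q.
  have /andP[h _] := sC j.
  rewrite -[q]opprK powRN -invfM lef_pV2 ?posrE ?mulr_gt0 ?powR_gt0 ?exprn_gt0//.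
split=> j jk.
  have Jk : A * n%:R `^ b <= (j.+1)%:R.
    by rewrite (le_trans kl)// ler_nat (leq_trans jk).
  have JN : n%:R `^ b <= (j.+1)%:R.
    by apply: le_trans Jk; rewrite ler_peMl// ltW.
  split.
  - have /andP[_ h] := sC j.
    apply: (@le_trans _ _ (D * (j.+1)%:R `^ (- (s2 + t2)))).
      apply: (@le_trans _ _ ((j.+1)%:R `^ (p - 1 - eps) * (C * (j.+1)%:R `^ (- q)) *
          (C `^ nu * (j.+1)%:R `^ (- t2)))).
        rewrite dwE; apply: ler_pM (snu j); last by rewrite ler_wpM2l ?powR_ge0.
          by apply: mulr_ge0; [exact: powR_ge0|exact: sqr_ge0].
        exact: sqr_ge0.
      rewrite (_ : - (s2 + t2) = (p - 1 - eps) + (- q) + (- t2)); last by rewrite /s2; ring.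
      by rewrite !Jadd /D le_eqVlt; apply/orP; left; apply/eqP; ring.
    apply: (@le_trans _ _ (D * (A * n%:R `^ b) `^ (- (s2 + t2)))).
      by rewrite ler_wpM2l ?(ltW D0)// powRN_le// ltW.
    rewrite powRM ?(ltW A0) ?powR_ge0// -powRrM mulrN bst (powRN _ 1) powRr1 ?ler0n//.
    by rewrite mulrA ler_wpM2r// invr_ge0 ltW.
  - apply: le_trans (snu j) _; apply: ler_pM; rewrite ?powR_ge0//.
      by rewrite le_max lexx.
    rewrite /r (_ : - (t2 * b) = b * - t2); last by ring.
    rewrite powRrM.
    by apply: powRN_le => //; exact: ltW.
  - rewrite dwE -Jadd.
    (* The exponent -1 - eps is split: -eps/2 is evaluated at n^b and gives [z], the rest stays
       summable in [j]. *)
    rewrite (_ : p - 1 - eps + - p = - (eps / 2) + - (1 + eps / 2)); last by field.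
    rewrite Jadd ler_wpM2r ?powR_ge0// /z -(mulrN b (eps / 2)) powRrM.
    by apply: powRN_le => //; lra.
have Jk : (j.+1)%:R <= 2 * A * n%:R `^ b.
  by apply: le_trans ku; rewrite ler_nat.
(* The balance behind b: since b (s2 + t2) = 1, noise amplification at the cutoff and squared bias
   have the same order [r]. *)
have rE : n%:R `^ (b * s2) / n%:R = r :> R.
  rewrite /r -[X in _ / X](powRr1 (ler0n _ n)) -powRN -Nadd; congr (_ `^ _).
  by rewrite -bst; ring.
have A20 : 0 <= 2 * A by rewrite mulr_ge0// ltW.
split.
- apply: (@le_trans _ _ (c^-1 * (2 * A * n%:R `^ b) `^ s2 * dw p eps j ^+ 2 / n%:R)).
    rewrite ler_wpM2r ?invr_ge0 ?ler0n//.
    apply: le_trans (sinv j) _.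
    rewrite (_ : q = s2 + (p - 1 - eps)); last by rewrite /s2; ring.
    rewrite Jadd -dwE mulrA ler_wpM2r ?sqr_ge0// ler_wpM2l ?invr_ge0 ?(ltW c0)//.
    by rewrite ge0_ler_powR ?nnegrE ?(ltW s20) ?ler0n// mulr_ge0// powR_ge0.
  rewrite powRM ?powR_ge0// -powRrM -rE.
  have -> : c^-1 * ((2 * A) `^ s2 * n%:R `^ (b * s2)) * dw p eps j ^+ 2 / n%:R =
     (c^-1 * (2 * A) `^ s2) * (n%:R `^ (b * s2) / n%:R) * dw p eps j ^+ 2.
    by field; rewrite gt_eqF//= gt_eqF.
  rewrite ler_wpM2r ?sqr_ge0// ler_wpM2r//.
  by rewrite !le_max lexx orbT.
- apply: (@le_trans _ _ (c^-1 * (2 * A * n%:R `^ b) `^ (s2 - eps / 2) *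
      (j.+1)%:R `^ (- (1 + eps / 2)) / n%:R)).
    rewrite ler_wpM2r ?invr_ge0 ?ler0n//.
    apply: (@le_trans _ _ (c^-1 * (j.+1)%:R `^ q * (j.+1)%:R `^ (- p))).
      by rewrite ler_wpM2r ?powR_ge0// sinv.
    rewrite -[leLHS]mulrA -Jadd.
    (* The exponent s2 - eps/2 is nonnegative because p - 1 < q, so this power may be raised to its
       value at the cutoff; a summable power remains. *)
    rewrite (_ : q + - p = (s2 - eps / 2) + - (1 + eps / 2)); last by rewrite /s2; field.
    rewrite Jadd mulrA ler_wpM2r ?powR_ge0// ler_wpM2l ?invr_ge0 ?(ltW c0)//.
    rewrite ge0_ler_powR ?nnegrE ?ler0n// ?mulr_ge0 ?powR_ge0 ?(ltW A0)//.
    by rewrite /s2; lra.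
  rewrite powRM ?powR_ge0// -powRrM.
  have rzE : r * z = n%:R `^ (b * (s2 - eps / 2)) / n%:R.
    by rewrite -rE /z mulrAC -Nadd; congr (_ `^ _ / _); ring.
  rewrite rzE.
  have -> : c^-1 * ((2 * A) `^ (s2 - eps / 2) * n%:R `^ (b * (s2 - eps / 2))) *
     (j.+1)%:R `^ (- (1 + eps / 2)) / n%:R =
     (c^-1 * (2 * A) `^ (s2 - eps / 2)) * (n%:R `^ (b * (s2 - eps / 2)) / n%:R) *
      (j.+1)%:R `^ (- (1 + eps / 2)).
    by field; rewrite gt_eqF//= gt_eqF.
  rewrite ler_wpM2r ?powR_ge0// ler_wpM2r//.
  by rewrite !le_max lexx !orbT.
Qed.

End power_rates.

(** * The discrepancy principle *)

Section sample_deviation.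
Context {R : realType}.

Lemma sum_sqr_deviation n (z : nat -> R) : (0 < n)%N ->
  let e := n%:R^-1 * \sum_(i < n) z i in
  \sum_(i < n) (z i - e) ^+ 2 = \sum_(i < n) z i ^+ 2 - n%:R * e ^+ 2.
Proof.
move=> n0 e.
have N0 : n%:R != 0 :> R by rewrite pnatr_eq0 -lt0n.
have se : \sum_(i < n) z i = n%:R * e by rewrite /e mulVKf.
under eq_bigr do rewrite sqrrB.
rewrite big_split/= sumrB sumr_const card_ord.
have -> : \sum_(i < n) z i * e *+ 2 = 2 * e * \sum_(i < n) z i.
  by rewrite mulr_sumr; apply: eq_bigr => i _; ring.
by rewrite se -(mulr_natl (e ^+ 2)); ring.
Qed.

Local Open Scope ereal_scope.

(** With [w j] = d_j^2 this is the square of [delta'_n]. It is fed with noise coordinates, since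
    centring at the sample mean removes the expectation. *)
Definition weighted_sample_variance (w : nat -> R) (z : nat -> nat -> R) (n : nat) : \bar R :=
  (n%:R^-1)%:E * ((n.-1%:R^-1)%:E * \sum_(i < n) \sum_(0 <= j <oo)
    (w j * (z i j - n%:R^-1 * \sum_(i < n) z i j) ^+ 2)%:E).

(** Centring at the sample mean only lowers the sum of squares in each coordinate, and 1/(n-1) <=
    2/n for n >= 2. *)
Lemma weighted_sample_variance_le (w : nat -> R) (z : nat -> nat -> R) n (c : R) :
  (1 < n)%N -> (forall j, (0 <= w j)%R) ->
  \sum_(i < n) \sum_(0 <= j <oo) (w j * z i j ^+ 2)%:E <= (n%:R * c)%:E ->
  weighted_sample_variance w z n <= (2 * c / n%:R)%:E.
Proof.
move=> n1 w0 zc; rewrite /weighted_sample_variance.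
have n0 : (0 < n)%N by exact: ltn_trans n1.
have N0 : (0 < n%:R :> R)%R by rewrite ltr0n.
have N1 : (0 < n.-1%:R :> R)%R by rewrite ltr0n -ltnS prednK.
have H : \sum_(i < n) \sum_(0 <= j <oo)
    (w j * (z i j - n%:R^-1 * \sum_(i < n) z i j) ^+ 2)%:E <= (n%:R * c)%:E.
  apply: le_trans zc.
  rewrite -!nneseries_sum; [|by move=> i j _; rewrite lee_fin mulr_ge0 ?sqr_ge0..].
  apply: lee_nneseries => [j _ _|j _].
    by apply: sume_ge0 => i _; rewrite lee_fin mulr_ge0 ?sqr_ge0.
  rewrite !sumEFin lee_fin -!mulr_sumr ler_wpM2l//.
  rewrite (sum_sqr_deviation n (fun i => z i j))// gerBl.
  by rewrite mulr_ge0 ?sqr_ge0.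
have NN : (n.-1%:R^-1 <= 2 / n%:R :> R)%R.
  rewrite -invf_div lef_pV2 ?posrE ?divr_gt0// ler_pdivrMr// -natrM ler_nat.
  by rewrite muln2 -addnn; move: n1; case: (n) => [|[|m]]//= _; rewrite addSn ltnS leq_addl.
have c0 : (0 <= n%:R * c)%R.
  rewrite -lee_fin; apply: le_trans zc; apply: sume_ge0 => i _.
  by apply: nneseries_ge0 => j _ _; rewrite lee_fin mulr_ge0 ?sqr_ge0.
apply: (@le_trans _ _ ((n%:R^-1)%:E * ((2 / n%:R)%:E * (n%:R * c)%:E))).
  rewrite lee_wpmul2l ?lee_fin ?invr_ge0 ?ler0n//.
  apply: (@le_trans _ _ (n.-1%:R^-1%:E * (n%:R * c)%:E)).
    by rewrite lee_wpmul2l ?lee_fin ?invr_ge0 ?ler0n.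
  by rewrite lee_wpmul2r ?lee_fin.
rewrite -!EFinM lee_fin le_eqVlt; apply/orP; left; apply/eqP.
by field; rewrite gt_eqF.
Qed.

(** All coordinates but that of index 0 are dropped; there the sum of squared deviations is n times
    the mean square minus the squared mean. *)
Lemma weighted_sample_variance_ge (w : nat -> R) (z : nat -> nat -> R) n (a b : R) :
  (1 < n)%N -> (forall j, (0 <= w j)%R) -> w 0%N = 1%R ->
  (a <= n%:R^-1 * \sum_(i < n) z i 0%N ^+ 2)%R ->
  ((n%:R^-1 * \sum_(i < n) z i 0%N) ^+ 2 <= b)%R -> (b <= a)%R ->
  ((a - b) / n%:R)%:E <= weighted_sample_variance w z n.
Proof.
move=> n1 w0 w01 za zb ba; rewrite /weighted_sample_variance.
have n0 : (0 < n)%N by exact: ltn_trans n1.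
have N0 : (0 < n%:R :> R)%R by rewrite ltr0n.
have N1 : (0 < n.-1%:R :> R)%R by rewrite ltr0n -ltnS prednK.
rewrite mulrC EFinM lee_wpmul2l ?lee_fin ?invr_ge0 ?ler0n//.
apply: (@le_trans _ _ ((n%:R^-1)%:E * (n%:R * (a - b))%:E)).
  by rewrite -EFinM lee_fin mulKf// gt_eqF.
apply: (@le_trans _ _ ((n.-1%:R^-1)%:E * (n%:R * (a - b))%:E)).
  rewrite lee_wpmul2r ?lee_fin ?mulr_ge0 ?subr_ge0 ?ler0n//.
  by rewrite lef_pV2 ?posrE// ler_nat leq_pred.
rewrite lee_wpmul2l ?lee_fin ?invr_ge0 ?ler0n//.
apply: (@le_trans _ _ (\sum_(i < n) ((z i 0%N - n%:R^-1 * \sum_(i < n) z i 0%N) ^+ 2)%:E)).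
  rewrite sumEFin lee_fin (sum_sqr_deviation n (fun i => z i 0%N))//.
  rewrite mulrBr; move: za; rewrite ler_pdivlMl// => za.
  by apply: lerB => //; rewrite ler_wpM2l.
apply: lee_sum => i _.
apply: le_trans (nneseries_lim_ge 1 _); last first.
  by move=> j _ _; rewrite lee_fin mulr_ge0 ?sqr_ge0.
by rewrite big_nat1 w01 mul1r.
Qed.

End sample_deviation.

(** * Deterministic bounds at and below a cutoff *)

Section cutoff_error.
Context {R : realType}.

(** Between [k] and [ks] the signal is data minus noise: the data part is charged to the residual
    and the noise part to the same sum as the noise below [k]. Letting that sum run up to the fixed
    [ks] removes the sample-dependent index [k] from the variance term. *)
Lemma cutoff_error_bound (sigma w yh e x xi : nat -> R) (k ks m : nat)
    (N M r c rho : R) :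
  0 < N -> 0 <= M -> 0 <= r -> (forall j, 0 <= w j) -> (forall j, 0 < sigma j) ->
  (forall j, yh j = sigma j * x j) ->
  (forall j, (ks <= j)%N -> x j ^+ 2 <= M * r * xi j ^+ 2) ->
  (forall j, (j < ks)%N -> sigma j ^- 2 / N <= M * r * w j) ->
  \sum_(j < m) xi j ^+ 2 <= rho ^+ 2 ->
  \sum_(j < ks) sigma j ^- 2 * e j ^+ 2 <= r ->
  \sum_(j < m) (if (k <= j)%N then w j * (yh j + e j) ^+ 2 else 0) <= 2 * c / N ->
  (k <= ks)%N -> (ks <= m)%N ->
  \sum_(j < m) ((if (j < k)%N then (sigma j)^-1 * (yh j + e j) else 0) - x j) ^+ 2 <=
    (2 + 4 * c * M + M * rho ^+ 2) * r.
Proof.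
move=> N0 M0 r0 w0 s0 yx xtail shead xirho er wr kks ksm.
(* [f1], [f2] and [f3] carry noise, residual and source condition; the factors 2 come from (a - b)^2
   <= 2 a^2 + 2 b^2. *)
pose f1 j := if (j < ks)%N then 2 * (sigma j ^- 2 * e j ^+ 2) else 0.
pose f2 j := 2 * N * M * r * (if (k <= j)%N then w j * (yh j + e j) ^+ 2 else 0).
pose f3 j := M * r * xi j ^+ 2.
have s20 j : 0 < sigma j ^- 2 by rewrite invr_gt0 exprn_gt0.
have H j : ((if (j < k)%N then (sigma j)^-1 * (yh j + e j) else 0) - x j) ^+ 2 <=
    f1 j + f2 j + f3 j.
  have f30 : 0 <= f3 j by apply: mulr_ge0 (sqr_ge0 _); exact: mulr_ge0.
  have s2 : sigma j ^- 2 = (sigma j)^-1 ^+ 2 by rewrite exprVn.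
  rewrite /f1 /f2; case: ltnP => jk.
    rewrite (leq_trans jk kks) mulr0 addr0.
    have -> : (sigma j)^-1 * (yh j + e j) - x j = (sigma j)^-1 * e j.
      by rewrite yx; field; rewrite gt_eqF.
    rewrite exprMn -s2.
    have : 0 <= sigma j ^- 2 * e j ^+ 2 by rewrite mulr_ge0 ?sqr_ge0 ?(ltW (s20 j)).
    by lra.
  rewrite sub0r sqrrN; case: ltnP => jks.
    have hs := shead j jks.
    have -> : x j = (sigma j)^-1 * ((yh j + e j) - e j).
      by rewrite yx; field; rewrite gt_eqF.
    set a := yh j + e j.
    have h1 : ((sigma j)^-1 * (a - e j)) ^+ 2 <=
        2 * (sigma j ^- 2 * e j ^+ 2) + 2 * (sigma j ^- 2 * a ^+ 2).
      have -> : ((sigma j)^-1 * (a - e j)) ^+ 2 = sigma j ^- 2 * (a - e j) ^+ 2.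
        by rewrite exprMn s2.
      rewrite !(mulrCA 2) -mulrDr ler_wpM2l ?(ltW (s20 j))//.
      have := sqr_ge0 (a + e j); nra.
    have h2 : sigma j ^- 2 * a ^+ 2 <= N * (M * r * w j) * a ^+ 2.
      by rewrite ler_wpM2r ?sqr_ge0// mulrC -ler_pdivrMr.
    move: h1 h2 f30; set A := sigma j ^- 2 * a ^+ 2.
    have -> : 2 * N * M * r * (w j * a ^+ 2) = 2 * (N * (M * r * w j) * a ^+ 2) by ring.
    by move=> *; lra.
  rewrite add0r; have := xtail j jks; rewrite -/(f3 j) => h.
  apply: le_trans h _; rewrite lerDr.
  by apply: mulr_ge0; [rewrite !mulr_ge0// ltW|exact: mulr_ge0 (sqr_ge0 _)].
apply: le_trans (ler_sum _ (fun (j : 'I_m) _ => H j)) _.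
rewrite !big_split/= -!mulr_sumr.
have S1 : \sum_(j < m) f1 j = 2 * \sum_(j < ks) sigma j ^- 2 * e j ^+ 2.
  rewrite -(big_mkord xpredT f1) (big_cat_nat (leq0n ks) ksm)/=.
  rewrite [X in _ + X]big1_seq ?addr0; last first.
    move=> j; rewrite mem_index_iota => /andP[_ /andP[jks _]].
    by rewrite /f1 ltnNge jks.
  rewrite big_mkord mulr_sumr; apply: eq_bigr => j _.
  by rewrite /f1 ltn_ord.
have S2 : 2 * N * M * r * \sum_(j < m)
    (if (k <= j)%N then w j * (yh j + e j) ^+ 2 else 0) <= 4 * c * M * r.
  apply: (@le_trans _ _ (2 * N * M * r * (2 * c / N))).
    by rewrite ler_wpM2l// !mulr_ge0// ltW.
  by rewrite le_eqVlt; apply/orP; left; apply/eqP; field; rewrite gt_eqF.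
have S3 : M * r * \sum_(j < m) xi j ^+ 2 <= M * rho ^+ 2 * r.
  by rewrite [leRHS]mulrAC ler_wpM2l// mulr_ge0.
rewrite S1; lra.
Qed.

(** Signal and noise beyond [ks] are each of size 1/N, with constants that can be made small; this
    is what makes the stopping test succeed at [ks]. *)
Lemma tail_residual_le (w yh e xi : nat -> R) (ks : nat) (N kappa rho a : R) :
  0 < N -> 0 <= kappa -> (forall j, 0 <= w j) ->
  (forall j, (ks <= j)%N -> w j * yh j ^+ 2 <= kappa / N * xi j ^+ 2) ->
  (forall m, \sum_(j < m) xi j ^+ 2 <= rho ^+ 2) ->
  (forall m, \sum_(j < m) (if (ks <= j)%N then w j * e j ^+ 2 else 0) <= a / N) ->
  (\sum_(ks <= j <oo) (w j * (yh j + e j) ^+ 2)%:E <=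
    (2 * (a + kappa * rho ^+ 2) / N)%:E)%E.
Proof.
move=> N0 k0 w0 wy xirho H.
apply: nneseries_le_partial => [j|m]; first by rewrite mulr_ge0 ?sqr_ge0.
apply: (@le_trans _ _ (\sum_(j < m)
   (2 * (if (ks <= j)%N then w j * e j ^+ 2 else 0) + 2 * (kappa / N) * xi j ^+ 2))).
  apply: ler_sum => j _.
  have h0 : 0 <= 2 * (kappa / N) * xi j ^+ 2.
    by apply: mulr_ge0 (sqr_ge0 _); rewrite mulr_ge0// divr_ge0// ltW.
  case: ifP => kj; last by rewrite mulr0 add0r.
  have h1 := wy j kj.
  have h2 : w j * (yh j + e j) ^+ 2 <= 2 * (w j * yh j ^+ 2) + 2 * (w j * e j ^+ 2).
    rewrite !(mulrCA 2) -mulrDr ler_wpM2l//.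
    have := sqr_ge0 (yh j - e j); nra.
  by lra.
rewrite big_split/= -!mulr_sumr.
have h1 := H m; have h2 : kappa / N * \sum_(i < m) xi i ^+ 2 <= kappa / N * rho ^+ 2.
  by rewrite ler_wpM2l// divr_ge0// ltW.
have -> : 2 * (a + kappa * rho ^+ 2) / N = 2 * (a / N) + 2 * (kappa / N * rho ^+ 2).
  by field; rewrite gt_eqF.
by rewrite -mulrA lerD// ler_wpM2l.
Qed.

End cutoff_error.

(** * The estimator and the stopping test in coordinates; measurability *)

Section estimator_coordinates.
Context {R : realType} {d : measure_display} {T : measurableType d}.
Context {Y : normedModType R} (ipY : inner_product Y) (u : nat -> Y).
Context (p eps : R) (Yr : nat -> T -> Y) (yhat : Y).

Definition noise_coord (i j : nat) (w : T) : R := ip ipY (Yr i w - yhat) (u j).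

Definition mean_noise (n j : nat) (w : T) : R :=
  n%:R^-1 * \sum_(i < n) noise_coord i j w.

(** At [n = 0] the sample mean is 0 while the right side keeps the coordinate of [yhat], hence the
    positivity condition. *)
Lemma ip_Ybar n j w : (0 < n)%N ->
  ip ipY (Ybar Yr n w) (u j) = ip ipY yhat (u j) + mean_noise n j w.
Proof.
move=> n0; rewrite /Ybar ipZl (ip_suml ipY n (fun i => Yr i w)) /mean_noise /noise_coord.
under [in RHS]eq_bigr do rewrite ipBl.
rewrite sumrB sumr_const card_ord -(mulr_natl (ip ipY yhat (u j))).
by field; rewrite pnatr_eq0 -lt0n.
Qed.

Lemma delta'E n w : (0 < n)%N ->
  delta' ipY u p eps Yr n w = sqrte (weighted_sample_variance
    (fun j => dw p eps j ^+ 2) (fun i j => noise_coord i j w) n).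
Proof.
move=> n0; rewrite /delta' /weighted_sample_variance [RHS]sqrteM; last first.
  by rewrite lee_fin invr_ge0.
have -> : sqrte (n%:R^-1)%:E = ((Num.sqrt n%:R)^-1 : R)%:E.
  by rewrite /= sqrtrV.
congr (_ * sqrte (_ * _))%E.
apply: eq_bigr => i _; apply: eq_eseriesr => j _.
by rewrite ipBl ip_Ybar// /noise_coord ipBl /mean_noise opprD addrA.
Qed.

Lemma weighted_sample_variance_ge0 (a : nat -> R) (z : nat -> nat -> R) n :
  (forall j, 0 <= a j) -> (0 <= weighted_sample_variance a z n)%E.
Proof.
move=> a0; rewrite mule_ge0 ?lee_fin ?invr_ge0// mule_ge0 ?lee_fin ?invr_ge0//.
apply: sume_ge0 => i _; apply: nneseries_ge0 => j _ _.
by rewrite lee_fin mulr_ge0 ?sqr_ge0.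
Qed.

Lemma tail_res_le_delta' n k w : (0 < n)%N ->
  (tail_res ipY u p eps Yr n k w <= delta' ipY u p eps Yr n w)%E =
  (\sum_(k <= j <oo) (dw p eps j ^+ 2 *
      (ip ipY yhat (u j) + mean_noise n j w) ^+ 2)%:E <=
   weighted_sample_variance (fun j => dw p eps j ^+ 2)%R
     (fun i j => noise_coord i j w) n)%E.
Proof.
move=> n0; rewrite delta'E// /tail_res lee_sqrt; last first.
  by apply: weighted_sample_variance_ge0 => j; exact: sqr_ge0.
congr (_ <= _)%E; apply: eq_eseriesr => j _.
by rewrite ip_Ybar.
Qed.

Hypothesis mYr : forall i j, measurable_fun setT (noise_coord i j).

Lemma measurable_mean_noise n j : measurable_fun setT (mean_noise n j).
Proof.
apply: measurable_funM => //; apply: measurable_sum => i; exact: mYr.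
Qed.

Lemma measurable_weighted_sample_variance n : measurable_fun setT
  (fun w => weighted_sample_variance (fun j => dw p eps j ^+ 2)%R
     (fun i j => noise_coord i j w) n).
Proof.
apply: emeasurable_funM => //; apply: emeasurable_funM => //.
apply: emeasurable_sum => i.
apply: (measurable_nneseries (fun j w => (dw p eps j ^+ 2 *
  (noise_coord i j w - mean_noise n j w) ^+ 2)%:E)) => [j w|j].
  by rewrite lee_fin mulr_ge0 ?sqr_ge0.
apply/measurable_EFinP/measurable_funM => //; apply: measurable_funX.
apply: measurable_funB; first exact: mYr.
exact: measurable_mean_noise.
Qed.

Lemma measurable_tail_res_le n k : (0 < n)%N ->
  measurable [set w | (tail_res ipY u p eps Yr n k w <= delta' ipY u p eps Yr n w)%E].
Proof.
move=> n0; rewrite (_ : [set w | _] = [set w | (\sum_(0 <= j <oo)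
    (dw p eps (j + k) ^+ 2 *
      (ip ipY yhat (u (j + k)%N) + mean_noise n (j + k) w) ^+ 2)%:E <=
   weighted_sample_variance (fun j => dw p eps j ^+ 2)%R
     (fun i j => noise_coord i j w) n)%E]); last first.
  have E w := @nneseries_addn R (fun j => (dw p eps j ^+ 2 *
      (ip ipY yhat (u j) + mean_noise n j w) ^+ 2)%:E) k.
  apply/seteqP; split => w /=; rewrite tail_res_le_delta'// -E// => j;
    by rewrite lee_fin mulr_ge0 ?sqr_ge0.
rewrite -[X in measurable X]setTI; apply: measurable_lee => //.
  apply: (measurable_nneseries (fun j w => (dw p eps (j + k) ^+ 2 *
      (ip ipY yhat (u (j + k)%N) + mean_noise n (j + k) w) ^+ 2)%:E)) => [j w|j].
    by rewrite lee_fin mulr_ge0 ?sqr_ge0.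
  apply/measurable_EFinP/measurable_funM => //; apply: measurable_funX.
  by apply: measurable_funD => //; exact: measurable_mean_noise.
exact: measurable_weighted_sample_variance.
Qed.

Lemma measurable_is_kn n k : (0 < n)%N ->
  measurable [set w | is_kn ipY u p eps Yr n w k].
Proof.
move=> n0; rewrite (_ : [set w | _] =
   [set w | (tail_res ipY u p eps Yr n k w <= delta' ipY u p eps Yr n w)%E] `&`
   \bigcap_(k' in [set k' | (k' < k)%N])
     ~` [set w | (tail_res ipY u p eps Yr n k' w <= delta' ipY u p eps Yr n w)%E]).
  apply: measurableI; first exact: measurable_tail_res_le.
  apply: bigcap_measurableType => k' _.
  by apply: measurableC; exact: measurable_tail_res_le.
by apply/seteqP; split => w.
Qed.

(** Orthonormality of [v] turns the squared error into a polynomial in finitely many real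
    coordinates, so no measurability of an [X]-valued map has to be discussed. *)
Lemma measurable_Xbar_error {X : normedModType R} (ipX : inner_product X)
    (sigma : nat -> R) (v : nat -> X) (xhat : X) n k (b : R) : (0 < n)%N ->
  Defs.orthonormal ipX v -> 0 <= b ->
  measurable [set w | `|Xbar ipY sigma u v Yr n k w - xhat| <= b].
Proof.
move=> n0 von b0.
pose a j w := (sigma j)^-1 * (ip ipY yhat (u j) + mean_noise n j w).
have ma j : measurable_fun setT (a j).
  apply: measurable_funM => //; apply: measurable_funD => //.
  exact: measurable_mean_noise.
pose F w := \sum_(j < k) (a j w) ^+ 2
   + 2 * (\sum_(j < k) a j w * ip ipX (v j) (- xhat)) + `|xhat| ^+ 2.
rewrite (_ : [set w | _] = setT `&` [set w | ((F w)%:E <= (b ^+ 2)%:E)%E]).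
  apply: emeasurable_fun_infty_c => //; apply/measurable_EFinP.
  apply: measurable_funD => //; apply: measurable_funD.
    by apply: measurable_sum => j; exact: measurable_funX.
  apply: measurable_funM => //; apply: measurable_sum => j.
  exact: measurable_funM.
rewrite setTI.
have E w : `|Xbar ipY sigma u v Yr n k w - xhat| ^+ 2 = F w.
  rewrite (norm_addsq ipX) normrN.
  have -> : Xbar ipY sigma u v Yr n k w = \sum_(j < k) a j w *: v j.
    by apply: eq_bigr => j _; rewrite ip_Ybar.
  rewrite (norm_sum_orthonormal ipX v von k (fun j => a j w)).
  rewrite (ip_suml ipX k (fun j => a j w *: v j)).
  by under [in X in _ + 2 * X]eq_bigr do rewrite ipZl.
apply/seteqP; split => w /=; rewrite lee_fin -E.
  by move=> h; rewrite lerXn2r// nnegrE.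
by rewrite ler_pXn2r// nnegrE.
Qed.

Lemma Xbar_error_limit {X : normedModType R} (sigma x : nat -> R) (v : nat -> X)
    (xhat : X) n k w :
  (0 < n)%N -> (fun m => \sum_(j < m) x j *: v j) @ \oo --> xhat ->
  (fun m => \sum_(j < m) ((if (j < k)%N then
     (sigma j)^-1 * (ip ipY yhat (u j) + mean_noise n j w) else 0) - x j) *: v j) @ \oo
    --> Xbar ipY sigma u v Yr n k w - xhat.
Proof.
move=> n0 xx.
pose f j := (if (j < k)%N then
     (sigma j)^-1 * (ip ipY yhat (u j) + mean_noise n j w) else 0).
have -> : (fun m => \sum_(j < m) (f j - x j) *: v j) =
  (fun m => \sum_(j < m) f j *: v j - \sum_(j < m) x j *: v j).
  by apply/funext => m; rewrite -sumrB; apply: eq_bigr => j _; rewrite scalerBl.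
apply: cvgB => //; apply: cvg_near_cst; near=> m.
have km : (k <= m)%N by near: m; exact: nbhs_infty_ge.
rewrite -(big_mkord xpredT (fun j => f j *: v j)) (big_cat_nat (leq0n k) km)/=.
rewrite [X in _ + X]big1_seq ?addr0; last first.
  move=> j; rewrite mem_index_iota => /andP[_ /andP[kj _]].
  by rewrite /f ltnNge kj scale0r.
rewrite big_mkord; apply: eq_bigr => j _.
by rewrite /f ltn_ord ip_Ybar.
Unshelve. all: by end_near. Qed.

End estimator_coordinates.

(** * The discrepancy principle on one good sample *)

Section discrepancy.
Context {R : realType} {d : measure_display} {T : measurableType d}.
Context {X Y : normedModType R} (ipX : inner_product X) (ipY : inner_product Y).
Context (u : nat -> Y) (v : nat -> X) (von : Defs.orthonormal ipX v).
Context (p eps : R) (Yr : nat -> T -> Y) (yhat : Y) (xhat : X).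
Local Notation noise := (noise_coord ipY u Yr yhat).
Local Notation mnoise := (mean_noise ipY u Yr yhat).

(** The sample [w] is fixed and every probabilistic fact is a hypothesis. The test succeeds at [ks],
    so a least index passing it exists and is at most [ks]; [cutoff_error_bound] then applies. *)
Lemma discrepancy_error (sigma x xi : nat -> R) (n ks : nat) (w : T)
    (M r c rho mu kappa : R) :
  (1 < n)%N -> 0 <= M -> 0 <= r -> 0 <= kappa -> (forall j, 0 < sigma j) ->
  (fun m => \sum_(j < m) x j *: v j) @ \oo --> xhat ->
  (forall j, ip ipY yhat (u j) = sigma j * x j) ->
  (forall m, \sum_(j < m) xi j ^+ 2 <= rho ^+ 2) ->
  (forall j, (ks <= j)%N -> x j ^+ 2 <= M * r * xi j ^+ 2) ->
  (forall j, (ks <= j)%N ->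
     dw p eps j ^+ 2 * (sigma j * x j) ^+ 2 <= kappa / n%:R * xi j ^+ 2) ->
  (forall j, (j < ks)%N -> sigma j ^- 2 / n%:R <= M * r * dw p eps j ^+ 2) ->
  16 * (kappa * rho ^+ 2) <= mu ->
  mu / 2 <= n%:R^-1 * \sum_(i < n) noise i 0%N w ^+ 2 ->
  mnoise n 0%N w ^+ 2 <= mu / 4 ->
  (\sum_(i < n) \sum_(0 <= j <oo) (dw p eps j ^+ 2 * noise i j w ^+ 2)%:E <=
     (n%:R * c)%:E)%E ->
  (forall m, \sum_(j < m) (if (ks <= j)%N then dw p eps j ^+ 2 * mnoise n j w ^+ 2
     else 0) <= mu / 16 / n%:R) ->
  \sum_(j < ks) sigma j ^- 2 * mnoise n j w ^+ 2 <= r ->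
  exists k, is_kn ipY u p eps Yr n w k /\
    `|Xbar ipY sigma u v Yr n k w - xhat| ^+ 2 <=
      (2 + 4 * c * M + M * rho ^+ 2) * r.
Proof.
move=> n1 M0 r0 k0 s0 xlim yx xirho xtail wtail shead kmu zlow e0 zup etail V.
have n0 : (0 < n)%N by exact: ltn_trans n1.
have N0 : 0 < n%:R :> R by rewrite ltr0n.
have mu0 : 0 <= mu by apply: le_trans kmu; rewrite mulr_ge0// mulr_ge0// sqr_ge0.
have w0 j : 0 <= dw p eps j ^+ 2 by exact: sqr_ge0.
have dw0 : dw p eps 0 ^+ 2 = 1 by rewrite /dw powR1 expr1n.
pose Q := weighted_sample_variance (fun j => dw p eps j ^+ 2)
  (fun i j => noise i j w) n.
have Qup : (Q <= (2 * c / n%:R)%:E)%E by exact: weighted_sample_variance_le.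
have Qlow : ((mu / 4 / n%:R)%:E <= Q)%E.
  have := @weighted_sample_variance_ge _ (fun j => dw p eps j ^+ 2)
    (fun i j => noise i j w) n (mu / 2) (mu / 4) n1 w0 dw0 zlow e0.
  have -> : mu / 2 - mu / 4 = mu / 4 by field.
  by apply; lra.
pose Pk k := `[< (tail_res ipY u p eps Yr n k w <= delta' ipY u p eps Yr n w)%E >].
have Pks : Pk ks.
  apply/asboolP; rewrite (tail_res_le_delta' ipY u p eps Yr yhat)//.
  apply: le_trans Qlow.
  apply: le_trans
    (@tail_residual_le _ (fun j => dw p eps j ^+ 2) (fun j => ip ipY yhat (u j))
      (fun j => mnoise n j w) xi ks n%:R kappa rho (mu / 16) N0 k0 w0 _ xirho etail) _.
    by move=> j kj; rewrite yx; exact: wtail.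
  (* Noise and signal contribute mu/16 each; doubled, they make mu/4 = mu/2 - mu/4, the lower bound
     for n [delta'_n]^2. *)
  rewrite lee_fin ler_wpM2r ?invr_ge0 ?ler0n//; lra.
have exk : exists k, Pk k by exists ks.
have [k Pkk kmin] := ex_minnP exk.
exists k; split.
  split; first exact/asboolP.
  by move=> k' k'k /asboolP/kmin; rewrite leqNgt k'k.
have kks : (k <= ks)%N by exact: kmin.
move/asboolP : Pkk; rewrite (tail_res_le_delta' ipY u p eps Yr yhat)// => Sk.
have {}Sk := le_trans Sk Qup.
pose cf j := (if (j < k)%N then
  (sigma j)^-1 * (ip ipY yhat (u j) + mnoise n j w) else 0) - x j.
apply: (@norm_limit_orthonormal_le _ _ ipX v von cf).
  exact: Xbar_error_limit.
near=> m.
have ksm : (ks <= m)%N by near: m; exact: nbhs_infty_ge.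
have wy : \sum_(j < m) (if (k <= j)%N then dw p eps j ^+ 2 *
    (ip ipY yhat (u j) + mnoise n j w) ^+ 2 else 0) <= 2 * c / n%:R.
  by apply: partial_le_nneseries Sk => j; rewrite mulr_ge0 ?sqr_ge0.
exact: (@cutoff_error_bound _ sigma (fun j => dw p eps j ^+ 2)
  (fun j => ip ipY yhat (u j)) (fun j => mnoise n j w) x xi k ks m n%:R M r c rho
  N0 M0 r0 w0 s0 yx xtail shead (xirho m) V wy kks ksm).
Unshelve. all: by end_near. Qed.

End discrepancy.

(** With s = q + 1 + eps - p one has nu'/(nu' + 1) = q nu/(s + q nu), so the squared rate of the
    theorem is the [r] of [rate_cutoff]. *)
Lemma rate_exponentE {R : realType} (q s nu : R) n : 0 < s -> 0 < q -> 0 < nu ->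
  (0 < n)%N ->
  let nu' := q / s * nu in
  (((Num.sqrt n%:R)^-1) `^ (nu' / (nu' + 1))) ^+ 2 =
    n%:R `^ (- (q * nu * (s + q * nu)^-1)) :> R.
Proof.
move=> s0 q0 nu0 n0 nu'.
have qn0 : 0 < q * nu by rewrite mulr_gt0.
rewrite -powR12_sqrt// -powRN -powRrM -powR_mulrn ?powR_ge0// -powRrM.
congr (_ `^ _); rewrite /nu'; field.
by rewrite !gt_eqF//= addr_gt0.
Qed.

Theorem theorem2 (R : realType)
  (X Y : completeNormedModType R) (ipX : inner_product X) (ipY : inner_product Y)
  (sepX : separable X) (sepY : separable Y)
  (K : {linear X -> Y}) (K_cont : continuous K)
  (K_compact : compact (closure (K @` [set x : X | `|x| <= 1])))
  (K_dense : closure (range K) = setT)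
  (sigma : nat -> R) (u : nat -> Y) (v : nat -> X)
  (u_onb : onb ipY u) (v_onb : onb_of ipX v (kernel_perp ipX K))
  (sigma_pos : forall j, 0 < sigma j)
  (sigma_noninc : forall j, sigma j.+1 <= sigma j)
  (sigma_to0 : sigma @ \oo --> 0)
  (svd : forall j, K (v j) = sigma j *: u j)
  (d : measure_display) (T : measurableType d) (P : probability T R)
  (Yr : nat -> T -> Y) (xhat : X) (yhat : Y) (hyhat : yhat = K xhat)
  (Yr_meas : forall i, borel_rv (Yr i))
  (Yr_indep : mutually_independent P Yr)
  (Yr_ident : identically_distributed P Yr)
  (Yr_mean : forall y : Y,
     P.-integrable setT (fun w => (ip ipY (Yr 0%N w) y)%:E) /\
     (\int[P]_w (ip ipY (Yr 0%N w) y)%:E = (ip ipY yhat y)%:E)%E)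
  (Yr_L2 : (\int[P]_w ((`|Yr 0%N w - yhat| ^+ 2)%:E) < +oo)%E)
  (q p : R) (hq : 0 < q) (hp : 1 < p) (hqp : p - 1 < q)
  (sigma_asymp : exists c C : R, 0 < c /\ 0 < C /\ forall j : nat,
     c * (j.+1)%:R `^ (- q) <= sigma j ^+ 2 <= C * (j.+1)%:R `^ (- q))
  (coord_asymp : exists c C : R, 0 < c /\ 0 < C /\ forall j : nat,
     ((c * (j.+1)%:R `^ (- p))%:E
        <= \int[P]_w ((ip ipY (Yr 0%N w - yhat) (u j)) ^+ 2)%:E
        <= (C * (j.+1)%:R `^ (- p))%:E)%E)
  (eps : R) (heps : 0 < eps) (hpeps : 1 + eps < p)
  (nu rho : R) (hnu : 0 < nu) (hrho : 0 < rho)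
  (hsource : source_set ipX sigma v nu rho xhat) :
  let nu' := q / (q + 1 + eps - p) * nu in
  exists L : R, 0 < L /\
    (fun n : nat => P [set w | exists k : nat, is_kn ipY u p eps Yr n w k /\
        `|Xbar ipY sigma u v Yr n k w - xhat|
          <= L * rho `^ (1 / (1 + nu')) * ((Num.sqrt n%:R)^-1) `^ (nu' / (nu' + 1))])
      @ \oo --> 1%:E.
Proof.
move=> nu'.
have [xi [xirho xlim]] := hsource.
have uon : Defs.orthonormal ipY u := u_onb.1.
have von : Defs.orthonormal ipX v := v_onb.1.
pose x j := sigma j `^ nu * ip ipX xi (v j).
have yx j : ip ipY yhat (u j) = sigma j * x j.
  apply: (@ip_limit_orthonormal _ _ ipY u uon (fun j => sigma j * x j)).
  rewrite hyhat.
  rewrite (_ : (fun n => _) = K \o (fun n => \sum_(j < n) x j *: v j)); last first.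
    apply/funext => n /=; rewrite linear_sum; apply: eq_bigr => i _.
    by rewrite linearZ/= svd scalerA mulrC.
  exact: cvg_comp xlim (K_cont xhat).
(* [v] spans only the orthogonal complement of the kernel, so Bessel's inequality takes the place of
   an identity. *)
have xib m : \sum_(j < m) ip ipX xi (v j) ^+ 2 <= rho ^+ 2.
  apply: le_trans (bessel ipX v von xi m) _.
  by rewrite lerXn2r// nnegrE// ltW.
pose YB := g_sigma_algebraType [set A : set Y | open A].
pose Z i : T -> YB := Yr i.
have mZ i : measurable_fun setT (Z i).
  by move=> _ B mB; rewrite setTI; exact: Yr_meas.
have Zindep i k (U V : set YB) : i != k -> measurable U -> measurable V ->
    (P (Z i @^-1` U `&` Z k @^-1` V) = P (Z i @^-1` U) * P (Z k @^-1` V))%E.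
  by move=> ik mU mV; exact: mutually_independent_pair.
have Zident i (U : set YB) : measurable U -> P (Z i @^-1` U) = P (Z 0%N @^-1` U).
  by move=> mU; exact: Yr_ident.
pose f j (y : YB) : R := ip ipY ((y : Y) - yhat) (u j).
have mf j : measurable_fun setT (f j).
  rewrite /f (_ : (fun _ => _) = fun y : YB => ip ipY (y : Y) (u j) - ip ipY yhat (u j)).
    apply: measurable_funB => //; exact: ip_measurable.
  by apply/funext => y; rewrite ipBl.
have mnc i j : measurable_fun setT (noise_coord ipY u Yr yhat i j).
  exact: (measurableT_comp (mf j) (mZ i)).
have f0 j : (\int[P]_w (f j (Z 0%N w))%:E = 0)%E.
  have [iY mY] := Yr_mean (u j).
  transitivity (\int[P]_w ((ip ipY (Yr 0%N w) (u j))%:E - cst (ip ipY yhat (u j))%:E w))%E.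
    by apply: eq_integral => w _; rewrite /f ipBl EFinB.
  rewrite integralB//; last exact: finite_measure_integrable_cst.
  rewrite integral_cst//= probability_setT mule1 mY subee//.
have [cs [Cs [cs0 [Cs0 hs]]]] := sigma_asymp.
have [cv [Cv [cv0 [Cv0 hv]]]] := coord_asymp.
have fv j : (\int[P]_w (f j (Z 0%N w) ^+ 2)%:E <= (Cv * (j.+1)%:R `^ (- p))%:E)%E.
  by have /andP[] := hv j.
(* The growing weights are not controlled by the norm of [Y], so [W] is extended-valued; [Woo] shows
   that its mean is finite. *)
pose W (y : YB) := (\sum_(0 <= j <oo) (dw p eps j ^+ 2 * f j y ^+ 2)%:E)%E.
have mWj j : measurable_fun setT (fun y => (dw p eps j ^+ 2 * f j y ^+ 2)%:E).
  by apply/measurable_EFinP/measurable_funM => //; exact: measurable_funX.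
have mW : measurable_fun setT W.
  apply: (measurable_nneseries (fun j y => (dw p eps j ^+ 2 * f j y ^+ 2)%:E)) => // j y.
  by rewrite lee_fin mulr_ge0 ?sqr_ge0.
have W0 y : (0 <= W y)%E.
  by apply: nneseries_ge0 => j _ _; rewrite lee_fin mulr_ge0 ?sqr_ge0.
have dwE j : dw p eps j ^+ 2 * (Cv * (j.+1)%:R `^ (- p)) =
    Cv * (j.+1)%:R `^ (- (1 + eps)).
  rewrite mulrCA /dw -powR_mulrn ?powR_ge0// -powRrM divfK ?pnatr_eq0//.
  by rewrite -powRD ?pnatr_eq0 ?implybT//; congr (_ * _ `^ _); ring.
have Woo : (\int[P]_w W (Z 0%N w) < +oo)%E.
  have [S [S0 hS]] := zeta_partial_sum_bounded eps heps.
  apply: (@le_lt_trans _ _ (Cv * S)%:E); last by rewrite ltry.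
  rewrite /W integral_nneseries//; first last.
  - by move=> j w _; rewrite lee_fin mulr_ge0 ?sqr_ge0.
  - by move=> j; exact: (measurableT_comp (mWj j) (mZ 0%N)).
  apply: (@le_trans _ _ (\sum_(0 <= j <oo) (Cv * (j.+1)%:R `^ (- (1 + eps)))%:E)%E).
    apply: lee_nneseries => [j _ _|j _].
      by apply: integral_ge0 => w _; rewrite lee_fin mulr_ge0 ?sqr_ge0.
    under eq_integral do rewrite EFinM.
    have mf2 : measurable_fun setT (fun w => (f j (Z 0%N w) ^+ 2)%:E).
      by apply/measurable_EFinP/measurable_funX; exact: (measurableT_comp (mf j) (mZ 0%N)).
    rewrite (ge0_integralZl_EFin P measurableT _ mf2 (sqr_ge0 _)); last first.
      by move=> w _; rewrite lee_fin sqr_ge0.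
    by rewrite -dwE [leRHS]EFinM lee_wpmul2l ?lee_fin ?sqr_ge0.
  apply: nneseries_le_partial => [j|m /=]; first by rewrite mulr_ge0 ?powR_ge0// ltW.
  by rewrite -mulr_sumr ler_wpM2l ?hS ?(ltW Cv0).
pose c := fine (\int[P]_w W (Z 0%N w))%E + 2.
have c0 : 0 <= c.
  by rewrite addr_ge0// fine_ge0// integral_ge0.
(* The squared coordinate is only known to be integrable; its capped version is bounded, lies below
   it and has mean [mu > 0]. *)
pose g (y : YB) := Num.min (f 0%N y ^+ 2) 1.
have mg : measurable_fun setT g.
  by apply: measurable_minr => //; exact: measurable_funX.
have gb y : 0 <= g y <= 1.
  by rewrite /g le_min ge_min lexx orbT sqr_ge0 ler01.
pose mu := fine (\int[P]_w (g (Z 0%N w))%:E)%E.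
have mu0 : 0 < mu.
  have gpos : (0 < \int[P]_w (g (Z 0%N w))%:E)%E.
    apply: (integral_min_sqr_gt0 P (fun w => f 0%N (Z 0%N w))).
      exact: (measurableT_comp (mf 0%N) (mZ 0%N)).
    have /andP[h _] := hv 0%N; apply: lt_le_trans h.
    by rewrite powR1 mulr1 lte_fin.
  apply: fine_gt0; rewrite gpos /=.
  apply: (@le_lt_trans _ _ (\int[P]_w (cst 1%:E w))%E); last first.
    by rewrite integral_cst//= probability_setT mule1 ltry.
  apply: ge0_le_integral => //.
  - by move=> w _; rewrite lee_fin; case/andP: (gb (Z 0%N w)).
  - by apply/measurable_EFinP; exact: (measurableT_comp mg (mZ 0%N)).
  - by move=> w _; rewrite lee_fin; case/andP: (gb (Z 0%N w)).
(* Chosen so that 16 kappa rho^2 = mu, which leaves the signal beyond the cutoff the share mu/16. *)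
pose kappa := mu / 16 / rho ^+ 2.
have rho20 : 0 < rho ^+ 2 by rewrite exprn_gt0.
have kappa0 : 0 < kappa by rewrite !divr_gt0.
have [ks [M [M0 hr]]] := rate_cutoff q p eps nu cs Cs kappa sigma hq hqp heps hpeps
  hnu cs0 Cs0 kappa0 sigma_pos hs.
set b := (q + 1 + eps - p + q * nu)^-1 in hr.
have s0 : 0 < q + 1 + eps - p by lra.
have b0 : 0 < b by rewrite invr_gt0 addr_gt0// mulr_gt0.
pose r n : R := n%:R `^ (- (q * nu * b)).
pose z n : R := n%:R `^ (- (b * (eps / 2))).
have z0 : z @ \oo --> (0 : R).
  by apply: powRN_natr_cvg0; rewrite mulr_gt0// divr_gt0.
have e20 : 0 < eps / 2 by rewrite divr_gt0.
have [S [S0 hS]] := zeta_partial_sum_bounded (eps / 2) e20.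
pose J j : R := (j.+1)%:R `^ (- (1 + eps / 2)).
have r_gt0 n : (0 < n)%N -> 0 < r n by move=> n0; rewrite powR_gt0// ltr0n.
have z_ge0 n : 0 <= z n by exact: powR_ge0.
(* [B1] and [B2] spoil the lower bound on [delta'_n], [B3] the upper bound, [B4] the smallness of
   the noise beyond the cutoff, and [B5] the variance bound below it. *)
pose B1 n := [set w | (((mu / 2) ^+ 2)%:E <=
  ((n%:R^-1 * \sum_(i < n) (g (Z i w) - mu)) ^+ 2)%:E)%E].
have v1 : vanishing P B1.
  by apply: (weak_law_bounded P Z mZ Zindep Zident g 1 (mu / 2)) => //; rewrite divr_gt0.
pose B3 n := [set w | ((n%:R * c)%:E <= \sum_(i < n) W (Z i w))%E].
have v3 : vanishing P B3.
  exact: (weak_law_upper P Z mZ Zindep Zident W mW W0 Woo).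
pose vv j := Cv * (j.+1)%:R `^ (- p).
pose E n a w := (\sum_(0 <= j <oo)
  (a j * (n%:R^-1 * \sum_(i < n) f j (Z i w)) ^+ 2)%:E)%E.
pose a2 (n j : nat) : R := (j == 0%N)%:R.
pose a4 n j := if (ks n <= j)%N then dw p eps j ^+ 2 else 0.
pose a5 n j := if (j < ks n)%N then sigma j ^- 2 else 0.
pose B2 n := [set w | ((mu / 4)%:E <= E n (a2 n) w)%E].
pose B4 n := [set w | ((mu / 16 / n%:R)%:E <= E n (a4 n) w)%E].
pose B5 n := [set w | ((r n)%:E <= E n (a5 n) w)%E].
(* For [B2], [B4] and [B5] the expectation is compared with the threshold: Cv/n with mu/4, Cv S
   z_n/n with mu/16/n, and Cv M S r_n z_n with r_n. *)
have v2 : vanishing P B2.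
  apply: (@weighted_mean_sq_vanishing _ _ _ _ _ P Z mZ Zindep Zident f vv a2
    (fun=> mu / 4) (fun n => 4 / mu * Cv * n%:R^-1)) => //.
  - rewrite -[X in _ --> X](mulr0 (4 / mu * Cv)); apply: cvgMr.
    rewrite gtr0_cvgV0; first exact: cvgr_idn.
    by near=> n; rewrite ltr0n; near: n; exact: nbhs_infty_gt.
  - move=> n n0; split=> [|m]; first by rewrite divr_gt0.
    have -> : 4 / mu * Cv / n%:R * (mu / 4) = Cv / n%:R.
      by field; rewrite !gt_eqF//= ?ltr0n.
    case: m => [|m]; first by rewrite big_ord0 divr_ge0// ltW.
    rewrite big_ord_recl big1/=; last by move=> j _; rewrite /a2 !mul0r.
    by rewrite /a2 /vv eqxx mul1r powR1 mulr1 addr0.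
have v4 : vanishing P B4.
  apply: (@weighted_mean_sq_vanishing _ _ _ _ _ P Z mZ Zindep Zident f vv a4
    (fun n => mu / 16 / n%:R) (fun n => 16 / mu * Cv * S * z n)) => //.
  - by move=> n j; rewrite /a4; case: ifP => // _; exact: sqr_ge0.
  - by rewrite -[X in _ --> X](mulr0 (16 / mu * Cv * S)); apply: cvgMr.
  - move=> n n0; split=> [|m]; first by rewrite !divr_gt0// ltr0n.
    have N0 : 0 < n%:R :> R by rewrite ltr0n.
    have -> : 16 / mu * Cv * S * z n * (mu / 16 / n%:R) = Cv / n%:R * z n * S.
      by field; rewrite !gt_eqF.
    apply: (@le_trans _ _ (\sum_(j < m) Cv / n%:R * z n * J j)).
      apply: ler_sum => j _; rewrite /a4 /vv; case: ifP => kj; last first.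
        by rewrite !mul0r mulr_ge0 ?powR_ge0// mulr_ge0// divr_ge0// ltW.
      have [_ _ h] := (hr n n0).1 j kj.
      rewrite mulrCA mulrAC -[leRHS]mulrA ler_wpM2l ?divr_ge0 ?(ltW Cv0)//.
    by rewrite -mulr_sumr ler_wpM2l ?hS// mulr_ge0// divr_ge0// ltW.
have v5 : vanishing P B5.
  apply: (@weighted_mean_sq_vanishing _ _ _ _ _ P Z mZ Zindep Zident f vv a5
    r (fun n => Cv * M * S * z n)) => //.
  - move=> n j; rewrite /a5; case: ifP => // _.
    by rewrite invr_ge0 exprn_ge0// ltW.
  - by rewrite -[X in _ --> X](mulr0 (Cv * M * S)); apply: cvgMr.
  - move=> n n0; split=> [|m]; first exact: r_gt0.
    have rz0 : 0 <= Cv * (M * (r n * z n)).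
      by rewrite mulr_ge0 ?(ltW Cv0)// mulr_ge0 ?(ltW M0)// mulr_ge0// ltW// r_gt0.
    have -> : Cv * M * S * z n * r n = Cv * (M * (r n * z n)) * S by ring.
    apply: (@le_trans _ _ (\sum_(j < m) Cv * (M * (r n * z n)) * J j)).
      apply: ler_sum => j _; rewrite /a5 /vv; case: ifP => kj; last first.
        by rewrite !mul0r mulr_ge0// powR_ge0.
      have [_ h] := (hr n n0).2 j kj.
      rewrite mulrCA -!mulrA ler_wpM2l ?(ltW Cv0)//.
      by rewrite /r /z /J; move: h; rewrite -!mulrA => h; exact: h.
    by rewrite -mulr_sumr ler_wpM2l ?hS.
pose L0 := 2 + 4 * c * M + M * rho ^+ 2.
have L00 : 0 < L0.
  have h1 : 0 <= c * M by rewrite mulr_ge0// ltW.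
  have h2 : 0 <= M * rho ^+ 2 by rewrite mulr_ge0 ?ltW.
  rewrite /L0; lra.
have rp0 : 0 < rho `^ (1 / (1 + nu')) by rewrite powR_gt0.
(* [L] may depend on [rho]; the division cancels the power of [rho] in the claimed bound. *)
exists (Num.sqrt L0 / rho `^ (1 / (1 + nu'))); split.
  by rewrite divr_gt0// sqrtr_gt0.
rewrite divfK ?gt_eqF//.
apply: (@vanishing_setC_cvg1 _ _ _ P _
  (fun n => B1 n `|` B2 n `|` B3 n `|` B4 n `|` B5 n)).
- near=> n.
  have n0 : (0 < n)%N by near: n; exact: nbhs_infty_gt.
  rewrite (_ : [set w | _] = \bigcup_k ([set w | is_kn ipY u p eps Yr n w k] `&`
    [set w | `|Xbar ipY sigma u v Yr n k w - xhat| <=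
      Num.sqrt L0 * (Num.sqrt n%:R)^-1 `^ (nu' / (nu' + 1))])).
    apply: bigcup_measurable => k _; apply: measurableI.
      exact: (measurable_is_kn ipY u p eps Yr yhat).
    apply: (@measurable_Xbar_error _ _ _ _ ipY u Yr yhat mnc _ ipX _ _ _ _ _ _ n0 von).
    by rewrite mulr_ge0 ?sqrtr_ge0 ?powR_ge0.
  by apply/seteqP; split => w [k]; [exists k|move=> _; exists k].
- by do 4 apply: vanishingU => //.
- near=> n => w /= nA; apply: contrapT.
  move=> /not_orP[/not_orP[/not_orP[/not_orP[nB1 nB2] nB3] nB4] nB5]; apply: nA.
  have n1 : (1 < n)%N by near: n; exact: nbhs_infty_gt.
  have n0 : (0 < n)%N by exact: ltn_trans n1.
  have N0 : 0 < n%:R :> R by rewrite ltr0n.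
  have partE a (B : R) : (forall j, 0 <= a j) -> ~ (B%:E <= E n a w)%E -> forall m,
      \sum_(j < m) a j * mean_noise ipY u Yr yhat n j w ^+ 2 <= B.
    move=> a0 /negP; rewrite -ltNge => /ltW EB m.
    apply: le_trans (@partial_le_nneseries _ _ _ 0 m _ EB); last first.
      by move=> j; rewrite mulr_ge0 ?sqr_ge0.
    by apply: ler_sum.
  have xtail j : (ks n <= j)%N -> x j ^+ 2 <= M * r n * ip ipX xi (v j) ^+ 2.
    move=> jk; have [_ h _] := (hr n n0).1 j jk.
    by rewrite /x exprMn ler_wpM2r ?sqr_ge0.
  have wtail j : (ks n <= j)%N -> dw p eps j ^+ 2 * (sigma j * x j) ^+ 2 <=
      kappa / n%:R * ip ipX xi (v j) ^+ 2.
    move=> jk; have [h _ _] := (hr n n0).1 j jk.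
    have -> : dw p eps j ^+ 2 * (sigma j * x j) ^+ 2 =
      dw p eps j ^+ 2 * sigma j ^+ 2 * (sigma j `^ nu) ^+ 2 * ip ipX xi (v j) ^+ 2.
      by rewrite /x; ring.
    by rewrite ler_wpM2r ?sqr_ge0.
  have shead j : (j < ks n)%N -> sigma j ^- 2 / n%:R <= M * r n * dw p eps j ^+ 2.
    by move=> jk; have [] := (hr n n0).2 j jk.
  have kmu : 16 * (kappa * rho ^+ 2) <= mu.
    by rewrite /kappa le_eqVlt; apply/orP; left; apply/eqP; field; rewrite gt_eqF.
  have zlow : mu / 2 <= n%:R^-1 * \sum_(i < n) noise_coord ipY u Yr yhat i 0%N w ^+ 2.
    move/negP : nB1; rewrite -ltNge lte_fin => nB1.
    (* A mean of [g - mu] below -mu/2 would have square at least (mu/2)^2 and put the sample in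
       [B1]. *)
    have h1 : - (mu / 2) <= n%:R^-1 * \sum_(i < n) (g (Z i w) - mu).
      rewrite leNgt; apply/negP => h; move: nB1; rewrite ltNge => /negP; apply.
      rewrite -[leRHS]sqrrN lerXn2r// ?nnegrE ?divr_ge0 ?(ltW mu0)//; lra.
    have h2 : n%:R^-1 * \sum_(i < n) (g (Z i w) - mu) <=
        n%:R^-1 * \sum_(i < n) noise_coord ipY u Yr yhat i 0%N w ^+ 2 - mu.
      rewrite sumrB sumr_const card_ord -(mulr_natl mu) mulrBr mulKf ?gt_eqF//.
      rewrite lerD2r ler_wpM2l ?invr_ge0 ?ler0n//; apply: ler_sum => i _.
      by rewrite /g ge_min lexx.
    lra.
  have e0 : mean_noise ipY u Yr yhat n 0%N w ^+ 2 <= mu / 4.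
    have h j : 0 <= a2 n j by rewrite /a2 ler0n.
    have := partE (a2 n) _ h nB2 1%N.
    by rewrite big_ord_recl big_ord0 /a2 eqxx mul1r addr0.
  have zup : (\sum_(i < n) \sum_(0 <= j <oo) (dw p eps j ^+ 2 *
      noise_coord ipY u Yr yhat i j w ^+ 2)%:E <= (n%:R * c)%:E)%E.
    by move/negP : nB3; rewrite -ltNge => /ltW.
  have etail m : \sum_(j < m) (if (ks n <= j)%N then dw p eps j ^+ 2 *
      mean_noise ipY u Yr yhat n j w ^+ 2 else 0) <= mu / 16 / n%:R.
    have h j : 0 <= a4 n j by rewrite /a4; case: ifP => // _; exact: sqr_ge0.
    apply: le_trans (partE (a4 n) _ h nB4 m); apply: ler_sum => j _.
    by rewrite /a4; case: ifP => //; rewrite mul0r.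
  have V : \sum_(j < ks n) sigma j ^- 2 * mean_noise ipY u Yr yhat n j w ^+ 2 <= r n.
    have h j : 0 <= a5 n j.
      by rewrite /a5; case: ifP => // _; rewrite invr_ge0 exprn_ge0// ltW.
    apply: le_trans (partE (a5 n) _ h nB5 (ks n)); apply: ler_sum => j _.
    by rewrite /a5 ltn_ord.
  have [k [kn err]] := @discrepancy_error _ _ _ _ _ ipX ipY u v von p eps Yr yhat xhat
    sigma x (fun j => ip ipX xi (v j)) n (ks n) w M (r n) c rho mu kappa n1 (ltW M0)
    (ltW (r_gt0 n n0)) (ltW kappa0) sigma_pos xlim yx xib xtail wtail shead kmu zlow
    e0 zup etail V.
  exists k; split=> //.
  rewrite -(@ler_pXn2r _ 2) ?nnegrE ?normr_ge0 ?mulr_ge0 ?sqrtr_ge0 ?powR_ge0//.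
  rewrite exprMn sqr_sqrtr ?(ltW L00)//.
  by rewrite (rate_exponentE q (q + 1 + eps - p) nu n s0 hq hnu n0).
Unshelve. all: by end_near. Qed.
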